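(* Let $m>1$ be an integer, let $\lambda$ be a maya diagram of size $n$ and let $\mu$ be a partition of $n-m$ which does not have any multiple of $m$ as a part. Then $$\chi_{\lambda}(\mu\cup(m))=\chi_{-\phi(\lambda)}(\mu),$$ where $\phi=\phi^{(m)}_1$, $\mu\cup(m)$ is the partition obtained by appending a part $m$ to $\mu$, and $\chi_\kappa(\nu)$ is extended linearly in $\kappa$ to $\kappa\in F$.
   Context: A maya diagram is a sequence of integers $[x_1,x_2,\ldots]$ with $x_1>x_2>\cdots$ and $x_i=-i$ for all sufficiently large $i$. Maya diagrams correspond bijectively to partitions: $\lambda=(\lambda_1,\ldots,\lambda_l)$ (extended by infinitely many zeros) corresponds to $[\lambda_1-1,\lambda_2-2,\lambda_3-3,\ldots]$. The same symbol is used for a partition and its maya diagram; the size of a maya diagram is the size $|\lambda|=\sum_i\lambda_i$ of its partition. A charged maya diagram is a strictly decreasing integer sequence $[x_1,x_2,\ldots]$ with $x_{i+1}=x_i-1$ for all sufficiently large $i$. Let $F$ (resp. $\tilde F$) be the $\mathbb{C}$-vector space with basis the set of all maya diagrams (resp. charged maya diagrams). A sequence satisfying the condition at large $i$ but not necessarily decreasing is regarded as an element of $F$ (resp. $\tilde F$) by the rule $[\ldots,i,\ldots,j,\ldots]+[\ldots,j,\ldots,i,\ldots]=0$ (swapping two entries changes the sign; sequences with a repeated entry are zero). For integers $m$ and $k$, the linear operator $\phi^{(m)}_k:F\to F$ is defined on maya diagrams by $$\phi^{(m)}_k([x_1,x_2,\ldots])=\Bigl(\sum_{a_0,\ldots,a_{m-1}}[a_{m-1},a_{m-2},\ldots,a_0,x_1,x_2,\ldots]\Bigr)-m,$$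 where the sum is over all $m$-tuples of integers $(a_0,\ldots,a_{m-1})$ with $a_i\equiv i\pmod m$ and $a_0+\cdots+a_{m-1}=(0+1+\cdots+(m-1))-km$ (only finitely many terms are nonzero), and ''$-m$'' denotes the linear operator $[y_1,y_2,\ldots]\mapsto[y_1-m,y_2-m,\ldots]$. $\chi_\lambda$ is the irreducible (complex) character of the symmetric group $S_{|\lambda|}$ indexed in the usual way by the partition (or maya diagram) $\lambda$, and $\chi_\lambda(\mu)$ is its value at permutations of cycle type $\mu$. *)

(* Defs.v *)
From HB Require Import structures.
From mathcomp Require Import all_boot all_order all_algebra all_fingroup.
From mathcomp Require Import all_solvable all_field all_character.
From mathcomp Require Import boolp classical_sets functions cardinality fsbigop.
From mathcomp.multinomials Require Import freeg.

Set Implicit Arguments.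
Unset Strict Implicit.
Unset Printing Implicit Defensive.

Import Order.TTheory GRing.Theory Num.Theory.
Local Open Scope ring_scope.

(* A sequence x : nat -> int stands for [x 0, x 1, ...]: indices start at 0,
   so that the usual condition x_i = - i reads x i = - i.+1.  The field of
   complex numbers is rendered by algC, over which the MathComp character
   theory is developed. *)

Definition decreasing_seq (x : nat -> int) : Prop :=
  forall i j, (i < j)%N -> x j < x i.

Definition vacuum_from (x : nat -> int) (N : nat) : Prop :=
  forall i, (N <= i)%N -> x i = - (i.+1)%:Z.

Definition is_maya (x : nat -> int) : Prop :=
  decreasing_seq x /\ exists N, vacuum_from x N.

Definition is_charged_maya (x : nat -> int) : Prop :=
  decreasing_seq x /\ exists N, forall i, (N <= i)%N -> x i.+1 = x i - 1.

Record maya := Maya {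
  maya_seq :> nat -> int;
  mayaP : `[< is_maya maya_seq >] }.
HB.instance Definition _ := [isSub for maya_seq].
HB.instance Definition _ := [Choice of maya by <:].

Record charged_maya := ChargedMaya {
  charged_maya_seq :> nat -> int;
  charged_mayaP : `[< is_charged_maya charged_maya_seq >] }.
HB.instance Definition _ := [isSub for charged_maya_seq].
HB.instance Definition _ := [Choice of charged_maya by <:].

(* The linear extension of f to the free module on K. *)
Section LinExt.
Variables (R : nzRingType) (K : choiceType) (M : lmodType R) (f : K -> M).

Definition lin_ext (u : {freeg K / R}) : M := fglift f u.

Lemma lin_ext_is_linear : linear lin_ext.
Proof.
have addE (u v : {freeg K / R}) : lin_ext (u - v) = lin_ext u - lin_ext v.
  exact: lift_is_additive.
have zeroE : lin_ext 0 = 0 by rewrite -(subrr 0) addE subrr.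
have oppE u : lin_ext (- u) = - lin_ext u by rewrite -sub0r addE zeroE sub0r.
have plusE u v : lin_ext (u + v) = lin_ext u + lin_ext v.
  by rewrite -[v in LHS]opprK addE oppE opprK.
have sumE (s : seq K) (c : K -> R) :
    lin_ext (\sum_(z <- s) << c z *g z >>) = \sum_(z <- s) c z *: f z.
  elim/big_rec2: _ => [|z u v _ IH]; first exact: zeroE.
  by rewrite plusE IH /lin_ext liftU.
have scaleE a u : lin_ext (a *: u) = a *: lin_ext u.
  rewrite -[u in RHS]freeg_sumE sumE scaler_sumr.
  rewrite [a *: u](_ : _ = \sum_(z <- dom u) << a * coeff z u *g z >>) //.
  by rewrite sumE; apply: eq_bigr => z _; rewrite scalerA.
by move=> a u v; rewrite plusE scaleE.
Qed.
HB.instance Definition _ :=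
  GRing.isLinear.Build R {freeg K / R} M *:%R lin_ext lin_ext_is_linear.

Lemma lin_extU (z : K) : lin_ext << 1 *g z >> = f z.
Proof. by rewrite /lin_ext liftU scale1r. Qed.
End LinExt.

(* The vector spaces F and F-tilde. *)
Notation fock := {freeg maya / algC}.
Notation charged_fock := {freeg charged_maya / algC}.

Definition ket (x : maya) : fock := << 1 *g x >>.
Definition cket (y : charged_maya) : charged_fock := << 1 *g y >>.

Definition is_partition_of (n : nat) (mu : seq nat) : bool :=
  [&& sorted geq mu, 0%N \notin mu & sumn mu == n].

Definition add_part (m : nat) (mu : seq nat) : seq nat := sort geq (m :: mu).

Lemma vacuum_ex (x : maya) : exists N, `[< vacuum_from x N >].
Proof. by case: x => x /= /asboolP [_ [N xN]]; exists N; apply/asboolP. Qed.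

(* The least N such that x i = - i.+1 for all i >= N; this is the number of
   nonzero parts of the partition of x. *)
Definition maya_length (x : maya) : nat := ex_minn (vacuum_ex x).

Definition maya_partition (x : maya) : seq nat :=
  mkseq (fun i => absz (x i + (i.+1)%:Z)) (maya_length x).

Definition maya_size (x : maya) : nat := sumn (maya_partition x).

(* The permutation s of {0, ..., N-1}, extended by the identity to nat. *)
Definition perm_nat (N : nat) (s : 'S_N) (i : nat) : nat :=
  if insub i is Some j then val (s j) else i.

(* f is obtained from the decreasing sequence p.2 by the finitely supported
   permutation p.1 of its entries. *)
Definition rearranges (f : nat -> int) (p : {N : nat & 'S_N} * charged_maya) :=
  forall i, f i = p.2 (perm_nat (tagged p.1) i).

(* The element of charged_fock denoted by a sequence f satisfying the condition
   at large indices: if its entries are distinct, the sign of the sorting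
   permutation times the sorted sequence (which does not depend on the chosen
   p), and 0 if an entry is repeated, as no p exists then. *)
Definition wedge (f : nat -> int) : charged_fock :=
  if pselect (exists p, rearranges f p) is left ex then
    let p := projT1 (cid ex) in (-1) ^+ (odd_perm (tagged p.1)) *: cket p.2
  else 0.

Lemma shift_charged_subproof (d : int) (y : charged_maya) :
  `[< is_charged_maya (fun i => y i + d) >].
Proof.
case: y => y /= /asboolP [decr [N yN]]; apply/asboolP; split.
  by move=> i j ltij; rewrite ltrD2r; apply: decr.
by exists N => i leNi; rewrite yN // addrAC.
Qed.

Definition shift_charged (d : int) (y : charged_maya) : charged_maya :=
  ChargedMaya (shift_charged_subproof d y).

Definition shift (d : int) : {linear charged_fock -> charged_fock} :=
  lin_ext (fun y : charged_maya => cket (shift_charged d y)).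

Lemma charge_subproof (x : maya) : `[< is_charged_maya x >].
Proof.
case: x => x /= /asboolP [decr [N xN]]; apply/asboolP; split => //.
exists N => i leNi; rewrite !xN //; last exact: leqW.
by rewrite -opprD -PoszD addn1.
Qed.

Definition charge (x : maya) : charged_maya := ChargedMaya (charge_subproof x).

Definition fock_to_charged : {linear fock -> charged_fock} :=
  lin_ext (fun x : maya => cket (charge x)).

(* Left inverse of fock_to_charged; it is only used to give phi below the
   codomain fock, on elements that belong to the image of fock (phi_ketE). *)
Definition charged_to_fock : {linear charged_fock -> fock} :=
  lin_ext (fun y : charged_maya =>
    if insub (charged_maya_seq y) is Some x then ket x else 0).

(* [a_(m-1), ..., a_0, x_1, x_2, ...] *)
Definition prepend (m : nat) (a : {ffun 'I_m -> int}) (x : nat -> int) :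
    nat -> int :=
  fun i => if insub i is Some j then a (rev_ord j) else x (i - m)%N.

Definition phi_index (m : nat) (k : int) : set {ffun 'I_m -> int} :=
  [set a | (forall i : 'I_m, (a i = (i : nat)%:Z %[mod m%:Z])%Z) /\
           \sum_(i < m) a i = \sum_(i < m) (i : nat)%:Z - k * m%:Z].

Arguments phi_index : clear implicits.

(* phi on a basis element, before its codomain is restricted to fock. The sum
   over \in is the sum of the nonzero terms, of which there are finitely many. *)
Definition phi_maya (m : nat) (k : int) (x : maya) : charged_fock :=
  shift (- m%:Z) (\sum_(a \in phi_index m k) wedge (prepend a x)).

Definition phi (m : nat) (k : int) : {linear fock -> fock} :=
  lin_ext (fun x : maya => charged_to_fock (phi_maya m k x)).

Lemma charged_to_fockK (y : charged_maya) :
  is_maya y -> fock_to_charged (charged_to_fock (cket y)) = cket y.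
Proof.
move=> /asboolP ymaya; rewrite /charged_to_fock /cket /= lin_extU.
case: insubP => [x _ xy|]; last by rewrite ymaya.
rewrite /fock_to_charged /ket /= lin_extU /cket.
by congr (<< 1 *g _ >>); apply: val_inj.
Qed.

Lemma wedge_prepend_maya (m : nat) (a : {ffun 'I_m -> int}) (x : maya) p :
  rearranges (prepend a x) p ->
  is_maya (shift_charged (- m%:Z) p.2).
Proof.
case: p => -[N s] y /= sE.
have /asboolP [_ [M xM]] := mayaP x.
have /asboolP [ydecr _] := charged_mayaP y; split.
  by move=> i j ltij; rewrite ltrD2r; apply: ydecr.
exists (N + m + M)%N => i le_i.
have leNi : (N <= i)%N by apply: leq_trans le_i; rewrite -addnA leq_addr.
have leMi : (m + M <= i)%N by apply: leq_trans le_i; rewrite -addnA leq_addl.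
have lemi : (m <= i)%N by apply: leq_trans leMi; rewrite leq_addr.
have := sE i; rewrite /perm_nat /prepend /= !insubF ?ltnNge ?leNi ?lemi //=.
move=> <-; rewrite xM ?leq_subRL //.
by rewrite -opprD -PoszD addSn subnK.
Qed.

Lemma phi_ketE (m : nat) (k : int) (x : maya) :
  fock_to_charged (phi m k (ket x)) = phi_maya m k x.
Proof.
have -> : phi m k (ket x) = charged_to_fock (phi_maya m k x).
  by rewrite /phi /ket /= lin_extU.
rewrite /phi_maya.
elim/big_ind: _ => [|u v Hu Hv|a _].
- by rewrite !linear0.
- by rewrite !linearD Hu Hv.
rewrite /wedge; case: pselect => [ex|_]; last by rewrite !linear0.
case: cid => p /= /wedge_prepend_maya pm.
rewrite !linearZ; congr (_ *: _).
have -> : shift (- m%:Z) (cket p.2) = cket (shift_charged (- m%:Z) p.2).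
  by rewrite /shift /cket /= lin_extU.
exact: charged_to_fockK.
Qed.

(* The permutations preserving the fibers of f. *)
Definition fiber_stab (n : nat) (f : 'I_n -> nat) : {set 'S_n} :=
  [set s : 'S_n | [forall i, f (s i) == f i]].

Lemma fiber_stab_group_set (n : nat) (f : 'I_n -> nat) :
  group_set (fiber_stab f).
Proof.
apply/group_setP; split=> [|s t].
  by rewrite inE; apply/forallP=> i; rewrite perm1.
rewrite !inE => /forallP sP /forallP tP; apply/forallP=> i.
by rewrite permM (eqP (tP _)) sP.
Qed.

Canonical fiber_stab_group (n : nat) (f : 'I_n -> nat) :=
  Group (fiber_stab_group_set f).

(* The row and column stabilizers of the tableau of shape lambda filled with
   0, 1, 2, ... row by row. *)
Definition row_stab (lambda : seq nat) : {group 'S_(sumn lambda)} :=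
  fiber_stab_group (fun i => reshape_index lambda i).
Definition col_stab (lambda : seq nat) : {group 'S_(sumn lambda)} :=
  fiber_stab_group (fun i => reshape_offset lambda i).

Lemma sign_subproof (n : nat) (G : {group 'S_n}) :
  is_class_fun <<G>>%g [ffun s : 'S_n => (-1) ^+ odd_perm s *+ (s \in G) : algC].
Proof.
rewrite genGid; apply: intro_class_fun => [s t Gs Gt|s /negPf-> //].
by rewrite groupJ // Gs odd_permJ.
Qed.

Definition sign_cfun (n : nat) (G : {group 'S_n}) : 'CF(G) :=
  Cfun 0 (sign_subproof G).

(* The irreducible character of the symmetric group labelled by lambda: the
   unique irreducible constituent common to the characters induced from the
   trivial character of the row stabilizer and from the sign character of the
   column stabilizer (Frobenius, Young; James and Kerber, The representation
   theory of the symmetric group, 2.1).  It is the character of the Specht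
   module of lambda: (n) labels the trivial character, (1^n) the sign. *)
Definition irr_sym (lambda : seq nat) : 'CF([set: 'S_(sumn lambda)]) :=
  let ind_triv := 'Ind[[set: 'S_(sumn lambda)], row_stab lambda] 1 in
  let ind_sign :=
    'Ind[[set: 'S_(sumn lambda)]] (sign_cfun (col_stab lambda)) in
  if [pick i | (i \in irr_constt ind_triv) && (i \in irr_constt ind_sign)]
  is Some i then 'chi_i else 0.

Definition has_cycle_type (n : nat) (s : 'S_n) (nu : seq nat) : bool :=
  perm_eq (map (fun C : {set 'I_n} => #|C|) (enum (porbits s))) nu.

(* Value at any permutation of cycle type nu; the value is 0 when there is no
   such permutation, that is when nu is not a partition of the size of x. *)
Definition chi (x : maya) (nu : seq nat) : algC :=
  if [pick s : 'S_(maya_size x) | has_cycle_type s nu] is Some s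
  then irr_sym (maya_partition x) s else 0.

Definition chi_lin (kappa : fock) (nu : seq nat) : algC :=
  lin_ext (fun x : maya => chi x nu : algC^o) kappa.

(* Main.v *)
Require Import Defs.
From mathcomp Require Import all_boot all_order all_algebra all_fingroup.
From mathcomp Require Import all_solvable all_field all_character.
From mathcomp.multinomials Require Import freeg.
From mathcomp Require Import zify ring.

(** Let P_k send a wedge [x_1, x_2, ...] to the sum over i of the wedges in
    which x_i is lowered by k. The Murnaghan-Nakayama rule says that the value
    of the character of lambda at cycle type nu is the coefficient of the
    vacuum in P_(nu_1) P_(nu_2) ... applied to lambda; this number is [mn_sum].
    Granting it, two remarks prove the theorem.

    If m does not divide k, then phi commutes with P_k. By the Leibniz rule the
    difference consists of the wedges [a_(m-1), ..., a_0, x_1, ...] in which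
    some a_j has been lowered by k. Now a_j - k has the residue of another
    entry a_i, and swapping the two gives a term of the same kind with the
    opposite sign: the difference is zero ([sum_phi_exchange]).

    On the other hand the vacuum coefficients of phi and of P_m are opposite
    ([sum_phi_base]). In a term of phi that is a multiple of the vacuum each a_i
    is at most i, hence a_i = i but for one r with a_r = r - m; transposing the
    values r and r - m turns this term into minus the corresponding term of
    P_m. Hence moving phi through the operators P_k for the parts k of mu
    replaces it by - P_m in the end ([sum_phi_index]).

    All this takes place on finite vectors of integers: a wedge is remembered
    through the entries before its tail becomes that of the vacuum, and its
    pairing with another wedge is a determinant of zeros and ones.

    The Murnaghan-Nakayama rule has to be established for irreducible characters
    that are given as the common constituent of two induced characters. Let
    [jacobi_trudi x] be the alternating sum, over permutations w, of the
    permutation characters of S_n on the colourings of n points with colour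
    multiplicities x - w(vac). Grouping the coloured points by cycles shows that
    its values are the numbers [mn_sum] ([jacobi_trudi_cycle_type]). Its norm is
    1 ([jacobi_trudi_norm]): by Burnside's lemma the inner products count
    matrices with prescribed margins, with signs, and these counts obey the
    recursion that the energy operator imposes on the pairing of wedges
    ([energy], [cauchy_sumE]). So it is plus or minus an irreducible character.
    Finally, by dominance, only the term of w = 1 shares a constituent with the
    character induced from the sign character of the column stabilizer, and
    those two share exactly one, with multiplicity one. It follows that
    [jacobi_trudi x] is this constituent ([jacobi_trudi_common_constituent]). *)

Set Implicit Arguments.
Unset Strict Implicit.
Unset Printing Implicit Defensive.

Import Order.TTheory GRing.Theory Num.Theory.
Local Open Scope ring_scope.

(** * Wedges of integer vectors and their pairing *)

Section Pairing.
Variable N : nat.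
Implicit Types x y : 'rV[int]_N.

(** The inner product of the wedges of x and y. Written as a determinant it
    requires no sorting of the entries, and it is antisymmetric in them. *)
Definition pairing x y : algC := \det (\matrix_(i, j) (x 0 i == y 0 j)%:R).

Definition raise (k : int) (i : 'I_N) x : 'rV[int]_N := x + k *: delta_mx 0 i.

Definition vac : 'rV[int]_N := \row_j - (j.+1)%:Z.

Lemma raiseE k i x j : raise k i x 0 j = if j == i then x 0 j + k else x 0 j.
Proof.
rewrite !mxE eqxx /=; case: eqP => _; first by rewrite mulr1.
by rewrite mulr0 addr0.
Qed.

Lemma raiseC k i l j x : raise k i (raise l j x) = raise l j (raise k i x).
Proof. by rewrite /raise addrAC. Qed.

Lemma raise0 i x : raise 0 i x = x.
Proof. by rewrite /raise scale0r addr0. Qed.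

Lemma raiseK k i x : raise k i (raise (- k) i x) = x.
Proof. by rewrite /raise -addrA scaleNr addNr addr0. Qed.

Lemma sum_raise k i x : \sum_j raise k i x 0 j = \sum_j x 0 j + k.
Proof.
under eq_bigr do rewrite mxE; rewrite big_split /= (bigD1 i) //=; congr (_ + _).
rewrite (bigD1 i) //= !mxE !eqxx mulr1 big1 ?addr0 // => j /negPf nji.
by rewrite !mxE nji mulr0.
Qed.

Lemma pairing_perm (s : 'S_N) x y :
  pairing (col_perm s x) y = (-1) ^+ odd_perm s * pairing x y.
Proof.
rewrite /pairing -det_perm -det_mulmx -row_permE; congr (\det _).
by apply/matrixP=> i j; rewrite !mxE.
Qed.

Lemma pairingC x y : pairing x y = pairing y x.
Proof.
rewrite /pairing -det_tr; congr (\det _).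
by apply/matrixP=> i j; rewrite !mxE eq_sym.
Qed.

Lemma pairing_eq0 (i j : 'I_N) x y : i != j -> x 0 i = x 0 j -> pairing x y = 0.
Proof. by move=> nij xij; apply: (determinant_alternate nij) => k; rewrite !mxE xij. Qed.

Lemma pairing_neq0 x y i : pairing x y != 0 -> exists j, x 0 i = y 0 j.
Proof.
move=> D; suff /fintype.existsP[j /eqP xj]: [exists j, x 0 i == y 0 j] by exists j.
apply: contra_neqT D => /fintype.existsPn nx.
rewrite /pairing (expand_det_row _ i) big1 // => j _.
by rewrite mxE (negPf (nx j)) mul0r.
Qed.

Lemma pairing_inj x y : pairing x y != 0 -> injective (x 0).
Proof.
move=> D i j xij; apply/eqP; apply: contra_neqT D => nij.
exact: pairing_eq0 nij xij.
Qed.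

Lemma pairing_refl x : injective (x 0) -> pairing x x = 1.
Proof.
move=> xI; rewrite /pairing (_ : \matrix_(i, j) _ = 1%:M) ?det1 //.
by apply/matrixP=> i j; rewrite !mxE (inj_eq xI); case: eqP.
Qed.

(** Expanding along the replaced row or column, both sides become the sum of
    the G i j times the cofactors of E. *)
Lemma sum_det_replace (E G : 'M[algC]_N) :
  \sum_i \det (\matrix_(a, b) if a == i then G a b else E a b) =
  \sum_j \det (\matrix_(a, b) if b == j then G a b else E a b).
Proof.
transitivity (\sum_i \sum_j G i j * cofactor E i j).
  apply: eq_bigr => i _; rewrite (expand_det_row _ i); apply: eq_bigr => j _.
  rewrite mxE eqxx; congr (_ * ( _ * \det _)); apply/matrixP=> a b.
  by rewrite !mxE [_ == i]eq_sym (negPf (neq_lift _ _)).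
rewrite exchange_big; apply: eq_bigr => j _; rewrite (expand_det_col _ j).
apply: eq_bigr => i _.
rewrite mxE eqxx; congr (_ * ( _ * \det _)); apply/matrixP=> a b.
by rewrite !mxE [_ == j]eq_sym (negPf (neq_lift _ _)).
Qed.

(** Raising entries is adjoint to lowering them: [sum_det_replace] for the
    matrix with entries x_i + k == y_j. *)
Lemma sum_pairing_raise k x y :
  \sum_i pairing (raise k i x) y = \sum_j pairing x (raise (- k) j y).
Proof.
rewrite /pairing.
have := sum_det_replace (\matrix_(a, b) (x 0 a == y 0 b)%:R)
  (\matrix_(a, b) (x 0 a + k == y 0 b)%:R).
congr (_ = _); apply: eq_bigr => i _; congr (\det _); apply/matrixP=> a b;
  rewrite !mxE eqxx /=; case: eqP => _; rewrite ?mulr1 ?mulr0 ?addr0 //.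
by rewrite -[in RHS](inj_eq (addIr k)) subrK.
Qed.

(** The reflection t -> p + q - t kills the sum over the interval from q to p,
    bounds included. *)
Lemma sum_antisym (z : nat -> algC) (p q : nat) :
  (forall t, (t <= p + q)%N -> z (p + q - t)%N = - z t) ->
  \sum_(0 <= t < p) z t - \sum_(0 <= t < q) z t = - z p.
Proof.
wlog lepq : p q / (q <= p)%N => [wl|].
  case: (leqP q p) => [/wl//|/ltnW lpq zE].
  have := wl q p lpq; rewrite addnC => /(_ zE).
  have := zE q; rewrite leq_addl addnK => /(_ isT) ->.
  by move=> h; rewrite -opprB h.
move=> zE; rewrite (@big_cat_nat _ _ _ q 0%N p) //= addrAC subrr add0r.
have S0 : \sum_(q <= t < p.+1) z t = 0.
  have: \sum_(q <= t < p.+1) z t = - \sum_(q <= t < p.+1) z t.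
    rewrite [LHS]big_nat_rev /= -sumrN; apply: eq_big_nat => t /andP[qt tp].
    by rewrite -zE; [congr z; lia | lia].
  by move/eqP; rewrite -addr_eq0 -mulr2n mulrn_eq0 /= => /eqP.
by move: S0; rewrite big_nat_recr //= => /eqP; rewrite addr_eq0 => /eqP.
Qed.

Lemma sum_vac2 : (\sum_j vac 0 j) *+ 2 = - (N * N.+1)%:Z.
Proof.
rewrite (eq_bigr (fun j : 'I_N => - (j.+1)%:Z)) => [|j _]; last by rewrite mxE.
elim: N => [|n IH]; first by rewrite big_ord0 mul0n.
by rewrite big_ord_recr /= mulrnDl IH; lia.
Qed.

(** The sum over k > 0 of the operators P_(-k) P_k is diagonal, and its
    eigenvalue is the size of the diagram. The terms with a = i give the sum of
    the heights of the entries above - N. For i <> a, the terms that lower one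
    of the two entries and raise the other run over the ways to redistribute
    x_i + x_a, and exchanging the two new values cancels them, except for one
    copy of - pairing x y for each pair. *)
Lemma energy x y (K : nat) :
    (forall i, 0 <= x 0 i + N%:Z <= K%:Z) ->
  \sum_(k < K) \sum_(i | k.+1%:Z <= x 0 i + N%:Z) \sum_a
     pairing (raise k.+1%:Z a (raise (- k.+1%:Z) i x)) y =
  (\sum_j x 0 j - \sum_j vac 0 j)%:~R * pairing x y.
Proof.
move=> xK.
pose p i := absz (x 0 i + N%:Z).
have pE i : (p i)%:Z = x 0 i + N%:Z by have := xK i; rewrite /p; lia.
(* z i a t: entry i is set to t - N and entry a compensates. *)
pose z i a (t : nat) := pairing (raise ((p i)%:Z - t%:Z) a (raise (t%:Z - (p i)%:Z) i x)) y.
have zE i a t : i != a -> (t <= p i + p a)%N -> z i a (p i + p a - t)%N = - z i a t.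
  move=> nia tp; rewrite /z; set u := raise _ a _; set v := raise _ a _.
  have -> : u = col_perm (tperm i a) v.
    have [pi pa] := (pE i, pE a).
    apply/rowP=> j; rewrite [RHS]mxE !raiseE.
    case: tpermP => [->|->|/eqP nji /eqP nja]; rewrite ?eqxx.
    - by rewrite (negPf nia) eq_sym (negPf nia); lia.
    - by rewrite [a == i]eq_sym (negPf nia); lia.
    - by rewrite (negPf nji) (negPf nja).
  by rewrite pairing_perm odd_tperm nia expr1 mulN1r.
pose f i a := \sum_(0 <= t < p i) z i a t.
have fE i a : i != a -> f i a + f a i = - pairing x y.
  move=> nia; (* Setting entry a to t - N and compensating on entry i is, up to exchanging
     the two values, setting entry i to t - N. *)
  have -> : f a i = - \sum_(0 <= t < p a) z i a t.
    rewrite /f -sumrN; apply: eq_big_nat => t /andP[_ tp].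
    rewrite -zE //; last by lia.
    rewrite /z [in RHS]raiseC.
    have -> : t%:Z - (p a)%:Z = (p i)%:Z - (p i + p a - t)%N%:Z by lia.
    by have -> : (p a)%:Z - t%:Z = (p i + p a - t)%N%:Z - (p i)%:Z by lia.
  rewrite (sum_antisym (zE i a ^~ nia)).
  by rewrite /z subrr !raise0.
have -> : \sum_(k < K) \sum_(i | k.+1%:Z <= x 0 i + N%:Z) \sum_a
     pairing (raise k.+1%:Z a (raise (- k.+1%:Z) i x)) y = \sum_i \sum_a f i a.
  rewrite (exchange_big_dep predT) //=; apply: eq_bigr => i _.
  rewrite exchange_big /=; apply: eq_bigr => a _; rewrite /f big_mkcond /=.
  rewrite big_nat_rev /= add0n big_mkord.
  have lepK : (p i <= K)%N by have := xK i; rewrite -pE; lia.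
  rewrite (big_ord_widen K (fun t => z i a (p i - t.+1)%N)) // [RHS]big_mkcond /=.
  apply: eq_bigr => k _; rewrite -pE; case: ltnP => kp; last by rewrite ifF //; lia.
  rewrite ifT /z; last by lia.
  have -> : k.+1%:Z = (p i)%:Z - (p i - k.+1)%N%:Z by lia.
  by rewrite opprB.
have S : (\sum_i \sum_a f i a) *+ 2 =
   (((\sum_i (x 0 i + N%:Z)) *+ 2) - (N * N.-1)%:Z)%:~R * pairing x y.
  transitivity (\sum_i \sum_a (f i a + f a i)).
    rewrite mulr2n [in X in _ + X = _]exchange_big -big_split /=.
    by apply: eq_bigr => i _; rewrite -big_split.
  under eq_bigr => i _.
    rewrite (bigD1 i) //= (eq_bigr (fun=> - pairing x y)) => [|a nai]; last first.
      by rewrite fE // eq_sym.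
    rewrite sumr_const cardC1 card_ord.
    have -> : f i i = (x 0 i + N%:Z)%:~R * pairing x y.
      rewrite /f (eq_bigr (fun=> pairing x y)) => [|t _]; last first.
        by rewrite /z -[t%:Z - _]opprB raiseK.
      by rewrite sumr_const_nat subn0 -mulr_natl -pE.
    over.
  rewrite big_split /= sumr_const card_ord.
  rewrite big_split /= -mulr_suml -rmorph_sum /=.
  rewrite -mulr_natl -[_ *+ N.-1]mulr_natl.
  rewrite rmorphB rmorphMn /= pmulrn PoszM rmorphM /=.
  ring.
suff : (\sum_i \sum_a f i a) *+ 2 =
   ((\sum_j x 0 j - \sum_j vac 0 j)%:~R * pairing x y) *+ 2.
  by move/eqP; rewrite eqrMn2r //= => /eqP.
rewrite S -mulrnAl -rmorphMn /=; congr (_%:~R * _).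
rewrite mulrnBl sum_vac2 big_split /= sumr_const card_ord mulrnDl.
rewrite -addrA; congr (_ + _).
rewrite -mulr_natl natz; case: (N) => [|n]; first by [].
rewrite -mulr_natl; lia.
Qed.

End Pairing.
Arguments vac N : clear implicits.

(** * The coefficients of the Cauchy identity *)

Lemma sorted_ltn_ge (s : seq nat) d i :
  path ltn d s -> (i < size s)%N -> (d + i < nth 0 s i)%N.
Proof.
elim: s d i => [|a s IH] //= d [|i] /andP[da /IH h] /=; first by rewrite addn0.
by rewrite ltnS => /h; lia.
Qed.

(** Sorting reduces this to increasing sequences, in which the entry of index
    i is at least i. *)
Lemma leq_sum_injective (N : nat) (f : 'I_N -> nat) : injective f ->
  (\sum_(i < N) i <= \sum_i f i)%N /\
  ((\sum_i f i <= \sum_(i < N) i)%N -> forall i, (f i < N)%N).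
Proof.
move=> fI; pose s := sort leq (codom f).
have szs : size s = N by rewrite size_sort size_codom card_ord.
have s_lt : sorted ltn s.
  rewrite ltn_sorted_uniq_leq sort_uniq (sort_sorted leq_total) andbT.
  by rewrite (map_inj_uniq fI) enum_uniq.
have sge i : (i < N)%N -> (i <= nth 0 s i)%N.
  case: {+}s szs s_lt => [<-//|a t] /= <- at_lt; case: i => // i; rewrite ltnS.
  by move/(sorted_ltn_ge at_lt) => /=; lia.
have sumE : (\sum_i f i = \sum_(i < N) nth 0 s i)%N.
  transitivity (\sum_(k <- codom f) k)%N.
    by rewrite /codom /image_mem big_map big_enum.
  rewrite (perm_big s) /=; last by rewrite perm_sym perm_sort.
  by rewrite (big_nth 0%N) szs big_mkord.
rewrite sumE; split=> [|le_s i]; first by apply: leq_sum => i _; apply: sge.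
have sE : forall k : 'I_N, true -> nth 0%N s k = k.
  have E: (\sum_(k < N) (nth 0 s k - k) == 0)%N.
    rewrite sumnB => [|k _]; last exact: sge.
    by rewrite subn_eq0.
  move=> k _; move: E; rewrite sum_nat_eq0 => /forallP/(_ k)/=.
  by have := sge k (ltn_ord k); lia.
have: f i \in s by rewrite mem_sort codom_f.
move/(nthP 0%N) => [k]; rewrite szs => kN <-.
by rewrite (sE (Ordinal kN)).
Qed.

Section Cauchy.
Variable N : nat.
Implicit Types x y : 'rV[int]_N.

Definition height x (i : 'I_N) : nat := absz (x 0 i + N%:Z).

Lemma sum_height (x : 'rV[int]_N) : (forall i, 0 <= x 0 i + N%:Z) ->
  \sum_i x 0 i - \sum_i vac N 0 i =
  (\sum_i height x i)%N%:Z - (\sum_(i < N) i)%N%:Z.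
Proof.
move=> x0; have -> : (\sum_(i < N) i)%N%:Z = \sum_i (vac N 0 i + N%:Z).
  rewrite (reindex_inj rev_ord_inj) /= -[LHS]natz natr_sum /=.
  by apply: eq_bigr => i _; rewrite mxE natz; have := ltn_ord i; lia.
have -> : (\sum_i height x i)%N%:Z = \sum_i (x 0 i + N%:Z).
  rewrite -[LHS]natz natr_sum /=; apply: eq_bigr => i _.
  by rewrite natz /height; have := x0 i; lia.
rewrite !big_split /=; ring.
Qed.

Lemma pairing_sum_ge x y : (forall i, 0 <= x 0 i + N%:Z) ->
  pairing x y != 0 -> \sum_i vac N 0 i <= \sum_i x 0 i.
Proof.
move=> x0 /pairing_inj xI.
have fI : injective (height x).
  by move=> i j; rewrite /height => ij; apply: xI; have xi := x0 i; have xj := x0 j; lia.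
have [h _] := leq_sum_injective fI.
by rewrite -subr_ge0 sum_height //; lia.
Qed.

(** If the entries are distinct then they form a permutation of the vacuum,
    because their sum is the least possible. *)
Lemma pairing_sum_eq x y : (forall i, 0 <= x 0 i + N%:Z) ->
    \sum_i x 0 i = \sum_i vac N 0 i ->
  pairing x y = pairing x (vac N) * pairing y (vac N).
Proof.
move=> x0 Sx.
have [/injectiveP xI|/injectivePn [i [j nij xij]]] := boolP (injectiveb (x 0));
  last by rewrite !(pairing_eq0 _ nij xij) mul0r.
have fI : injective (height x).
  by move=> i j; rewrite /height => ij; apply: xI; have xi := x0 i; have xj := x0 j; lia.
have [_ fN] := leq_sum_injective fI.
have {fN} xN i : (height x i < N)%N.
  by apply: fN; have := sum_height x0; rewrite Sx subrr; lia.
pose h i := rev_ord (Ordinal (xN i)).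
have hI : injective h by move=> i j /rev_ord_inj/(congr1 val)/fI.
have -> : x = col_perm (perm hI) (vac N).
  apply/rowP=> i; rewrite !mxE permE /=.
  by have := xN i; have := x0 i; rewrite /height; lia.
rewrite !pairing_perm pairing_refl; last by move=> i j; rewrite !mxE => /oppr_inj[/val_inj].
by rewrite mulr1 pairingC.
Qed.

End Cauchy.

Section Mark.
Variables (T : finType) (K : nat).

(** The size n counts the units contained in the cells of M. Mark one of them,
    the k-th of its cell, and remove it from M together with the k units below
    it. *)
Lemma sum_mark n (Phi : {ffun T -> nat} -> algC) : (n <= K)%N ->
  n%:R * \sum_(M : {ffun T -> 'I_K.+1} | (\sum_c M c == n)%N)
            Phi [ffun c => M c : nat] =
  \sum_(k < n) \sum_c
     \sum_(M : {ffun T -> 'I_K.+1} | (\sum_c M c == n - k.+1)%N)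
        Phi [ffun d => M d + (k.+1) * (d == c)]%N.
Proof.
move=> nK.
transitivity (\sum_(M : {ffun T -> 'I_K.+1} | (\sum_c M c == n)%N)
   \sum_(k < n) \sum_(c | (k < M c)%N) Phi [ffun c => M c : nat]).
  rewrite mulr_sumr; apply: eq_bigr => M /eqP SM.
  transitivity (\sum_c \sum_(k < n | (k < M c)%N) Phi [ffun c => M c : nat]).
    rewrite -{1}SM natr_sum mulr_suml; apply: eq_bigr => c _.
    have McN : (M c <= n)%N by rewrite -SM (bigD1 c) //= leq_addr.
    by rewrite -(big_ord_widen n (fun=> Phi _)) // sumr_const card_ord mulr_natl.
  by apply: exchange_big_dep.
rewrite exchange_big; apply: eq_bigr => k _.
rewrite (exchange_big_dep predT) //=; apply: eq_bigr => c _.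
pose h (M : {ffun T -> 'I_K.+1}) := [ffun d => inord (M d + k.+1 * (d == c))%N : 'I_K.+1].
pose h' (M : {ffun T -> 'I_K.+1}) := [ffun d => inord (M d - k.+1 * (d == c))%N : 'I_K.+1].
have Sc : (\sum_d k.+1 * (d == c) = k.+1)%N.
  by rewrite (bigD1 c) //= eqxx muln1 big1 ?addn0 // => d /negPf->; rewrite muln0.
rewrite (reindex_onto h h') /=; last first.
  move=> M /andP[_ kM]; apply/ffunP=> d; rewrite !ffunE; apply/val_inj.
  have := ltn_ord (M d).
  case: eqP => [->|_] /=; rewrite ?muln1 ?muln0 ?subn0 ?addn0 => MK.
    by rewrite !inordK; lia.
  by rewrite !inordK.
have hE (M : {ffun T -> 'I_K.+1}) : (\sum_d M d == n - k.+1)%N ->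
    forall d, h M d = (M d + k.+1 * (d == c))%N :> nat.
  move=> /eqP SM d; rewrite ffunE /= inordK //.
  have : (M d <= n - k.+1)%N by rewrite -SM (bigD1 d) //= leq_addr.
  by have := ltn_ord k; case: eqP => _; lia.
have PE (M : {ffun T -> 'I_K.+1}) :
    (\sum_d h M d == n)%N && (k < h M c)%N && (h' (h M) == M) =
    (\sum_d M d == n - k.+1)%N.
  apply/idP/idP => [/andP[/andP[/eqP SM kM] /eqP hM]|SM].
    have e d : (M d + k.+1 * (d == c))%N = h M d.
      rewrite -{1}hM ffunE inordK; last by have := ltn_ord (h M d); lia.
      by case: eqP => [->|_]; lia.
    have : (\sum_d (M d + k.+1 * (d == c)) = n)%N by rewrite (eq_bigr _ (fun d _ => e d)).
    by rewrite big_split /= Sc; lia.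
  rewrite hE // eqxx muln1 [X in _ && X && _](_ : _ = true); last by lia.
  rewrite (eq_bigr _ (fun d _ => hE M SM d)) big_split /= Sc (eqP SM).
  rewrite subnK // eqxx /=; apply/eqP/ffunP => d; apply/val_inj.
  by rewrite ffunE /= hE // addnK inord_val.
apply: eq_big => M; rewrite PE // => SM; congr Phi; apply/ffunP=> d; rewrite ffunE [RHS]ffunE.
exact: hE.
Qed.

End Mark.

Section CauchySum.
Variable N : nat.
Implicit Types x y : 'rV[int]_N.

(** The vector of the totals of the M c over the fibres of w; for a matrix M and
    w a projection, its margins. *)
Definition content (T : finType) (w : T -> 'I_N) (M : {ffun T -> nat}) : 'rV[int]_N :=
  \sum_c (M c)%:Z *: delta_mx 0 (w c).

Lemma contentE T w M i : @content T w M 0 i = (\sum_(c | w c == i) M c)%N%:Z.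
Proof.
rewrite /content summxE -[RHS]natz natr_sum [RHS]big_mkcond /=.
apply: eq_bigr => c _; rewrite !mxE eqxx /= eq_sym.
by case: eqP => _; rewrite ?mulr1 ?mulr0 ?natz.
Qed.

Lemma sub_contentE T w M x i :
  (x - @content T w M) 0 i = x 0 i - (\sum_(c | w c == i) M c)%N%:Z.
Proof. by rewrite -contentE !mxE. Qed.

Lemma content_mark (T : finType) (w : T -> 'I_N) (M : {ffun T -> nat}) k c x :
  x - content w [ffun d => M d + k * (d == c)]%N =
  raise (- k%:Z) (w c) x - content w M.
Proof.
rewrite /content /raise (eq_bigr (fun d => (M d)%:Z *: delta_mx 0 (w d) +
   (k * (d == c))%N%:Z *: delta_mx 0 (w d))) => [|d _]; last first.
  by rewrite ffunE PoszD scalerDl.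
rewrite big_split /= [X in _ - (_ + X)](bigD1 c) //= eqxx muln1.
rewrite [X in _ - (_ + (_ + X))]big1 ?addr0 => [|d /negPf->]; last first.
  by rewrite muln0 scale0r.
by rewrite opprD scaleNr addrA addrAC.
Qed.

Lemma content0 (T : finType) (w : T -> 'I_N) : content w [ffun=> 0%N] = 0.
Proof. by rewrite /content big1 // => c _; rewrite ffunE scale0r. Qed.

(** The coefficient that Cauchy's identity computes: the product of all
    1 / (1 - u_i v_j) expands over matrices M of natural numbers, and the two
    pairings extract the alternants in u and in v. The bound K only makes the
    index type finite. *)
Definition cauchy_sum K n x y : algC :=
  \sum_(M : {ffun 'I_N * 'I_N -> 'I_K.+1} | (\sum_c M c == n)%N)
    pairing (x - content fst [ffun c => M c : nat]) (vac N) *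
    pairing (y - content snd [ffun c => M c : nat]) (vac N).

Lemma pairing_vac_ge x i : pairing x (vac N) != 0 -> 0 <= x 0 i + N%:Z.
Proof.
by move=> /(pairing_neq0 i) [j ->]; rewrite mxE; have := ltn_ord j; lia.
Qed.

Lemma cauchy_sum_eq0 K n x y i : x 0 i + N%:Z < 0 -> cauchy_sum K n x y = 0.
Proof.
move=> xi; apply: big1 => M _; apply/eqP; rewrite mulf_eq0; apply/orP; left.
apply: contraT => /(pairing_vac_ge i); rewrite sub_contentE.
set r := (\sum_(c | _) _)%N; move: xi; clearbody r; lia.
Qed.

(** The analogue, for the coefficients, of n h_n being the sum of the
    p_k h_(n-k). *)
Lemma cauchy_sum_mark K n x y : (n <= K)%N ->
  n%:R * cauchy_sum K n x y = \sum_(k < n) \sum_i \sum_j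
    cauchy_sum K (n - k.+1)%N (raise (- k.+1%:Z) i x) (raise (- k.+1%:Z) j y).
Proof.
move=> nK; pose Phi (M : {ffun 'I_N * 'I_N -> nat}) :=
  pairing (x - content fst M) (vac N) * pairing (y - content snd M) (vac N).
rewrite -[cauchy_sum _ _ _ _]/(\sum_(M | _) Phi _) sum_mark //.
apply: eq_bigr => k _; rewrite [RHS]pair_big /=; apply: eq_bigr => -[i j] _ /=.
apply: eq_bigr => M _; rewrite /Phi.
have -> : [ffun d => M d + k.+1 * (d == (i, j))]%N =
  [ffun d => [ffun d => M d : nat] d + k.+1 * (d == (i, j))]%N.
  by apply/ffunP=> d; rewrite !ffunE.
by rewrite !content_mark.
Qed.

(** Both sides satisfy the same recursion on n: [cauchy_sum_mark] on the left,
    and on the right [energy], where one of the two factors is moved to y by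
    adjointness. *)
Lemma cauchy_sumE K n x y : (n <= K)%N -> (forall i, 0 <= x 0 i + N%:Z) ->
    \sum_i x 0 i = \sum_i vac N 0 i + n%:Z ->
  cauchy_sum K n x y = pairing x y.
Proof.
elim/ltn_ind: n x y => -[|n] IH x y nK x0 Sx.
  rewrite addr0 in Sx; rewrite pairing_sum_eq //.
  rewrite /cauchy_sum (big_pred1 [ffun=> ord0]) => [|M].
    rewrite (_ : [ffun c => _] = [ffun=> 0%N]); last by apply/ffunP=> c; rewrite !ffunE.
    by rewrite !content0 !subr0.
  rewrite sum_nat_eq0; apply/forallP/eqP => [M0|-> c]; last by rewrite ffunE.
  by apply/ffunP=> c; apply/val_inj; rewrite ffunE; apply/eqP/(M0 c).
have n0 : (n.+1%:R : algC) != 0 by rewrite pnatr_eq0.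
apply: (mulfI n0); rewrite cauchy_sum_mark //.
(* Any bound on the heights that is at least n.+1 will do. *)
pose K' := (\sum_i height x i + n.+1)%N.
have xK i : 0 <= x 0 i + N%:Z <= K'%:Z.
  rewrite x0 /= /K' (bigD1 i) //=; set r := (\sum_(i | _) _)%N.
  by have := x0 i; rewrite /height; lia.
have := energy y xK; rewrite Sx addrAC subrr add0r => <-.
(* The terms of the energy with k > n vanish, as x would get a sum below that
   of the vacuum. *)
have nK' : (n.+1 <= K')%N by rewrite leq_addl.
have tE (k : nat) : \sum_(i | k.+1%:Z <= x 0 i + N%:Z) \sum_a
   pairing (raise k.+1%:Z a (raise (- k.+1%:Z) i x)) y =
   \sum_i if k.+1%:Z <= x 0 i + N%:Z then
     \sum_j pairing (raise (- k.+1%:Z) i x) (raise (- k.+1%:Z) j y) else 0.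
  by rewrite big_mkcond; apply: eq_bigr => i _; rewrite sum_pairing_raise.
have r0 (k : nat) i : k.+1%:Z <= x 0 i + N%:Z ->
    forall l, 0 <= raise (- k.+1%:Z) i x 0 l + N%:Z.
  by move=> kx l; rewrite raiseE; case: eqP => [->|_]; [lia | exact: x0].
rewrite (big_ord_widen K' (fun k => \sum_i \sum_j
   cauchy_sum K (n.+1 - k.+1)%N (raise (- k.+1%:Z) i x) (raise (- k.+1%:Z) j y))) //.
rewrite big_mkcond /=; apply: eq_bigr => k _; case: ltnP => kn; last first.
  rewrite tE big1 // => i _; case: ifP => // kx; apply: big1 => j _.
  apply: contraTeq kn => /(pairing_sum_ge (r0 k i kx)).
  by rewrite sum_raise Sx; set v := \sum_i _; lia.
rewrite tE; apply: eq_bigr => i _; case: ifP => kx; last first.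
  by apply: big1 => j _; apply: (@cauchy_sum_eq0 _ _ _ _ i); rewrite raiseE eqxx; lia.
apply: eq_bigr => j _; apply: IH; [lia | lia | exact: r0 | ].
by rewrite sum_raise Sx -addrA; congr (_ + _); lia.
Qed.

End CauchySum.

(** * Colourings and the permutations that fix them *)

Section Colouring.
Variables (n : nat) (T : finType).
Implicit Types (F H : {ffun 'I_n -> T}) (s : 'S_n).

Definition fixes s F := [forall i, F (s i) == F i].

Definition fibre F : {ffun T -> nat} := [ffun c => #|[set i | F i == c]|].

Definition recolour s F : {ffun 'I_n -> T} := [ffun i => F (s i)].

Lemma fixesP s F : reflect (recolour s F = F) (fixes s F).
Proof.
apply: (iffP forallP) => [h|h i]; last by rewrite -{2}h ffunE.
by apply/ffunP=> i; rewrite ffunE; apply/eqP.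
Qed.

Lemma fibreE F c : fibre F c = count_mem c [tuple F i | i < n].
Proof.
rewrite ffunE cardE size_filter -enumT /= count_map.
by apply: eq_count => i; rewrite /= inE.
Qed.

Lemma fibre_recolour s F : fibre (recolour s F) = fibre F.
Proof.
apply/ffunP=> c; rewrite !ffunE -[RHS](card_preimset _ (@perm_inj _ s)).
by apply: eq_card => i; rewrite !inE ffunE.
Qed.

Lemma fibre_eq_recolour F H : fibre F = fibre H -> exists s, H = recolour s F.
Proof.
move=> FH; have: perm_eq [tuple H i | i < n] [tuple F i | i < n].
  by apply/allP=> c _ /=; rewrite -!fibreE FH.
case/tuple_permP=> s sE; exists s; apply/ffunP=> i; rewrite ffunE.
have := congr1 (fun t => nth (H i) t i) sE.
by rewrite -!tnth_nth !tnth_mktuple.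
Qed.

Lemma sum_fibre F : (\sum_c fibre F c = n)%N.
Proof.
rewrite -[RHS]card_ord -sum1_card (partition_big F predT) //=.
by apply: eq_bigr => c _; rewrite ffunE sum1dep_card.
Qed.

Lemma exists_fibre (M : {ffun T -> nat}) : (\sum_c M c = n)%N ->
  exists F, fibre F = M.
Proof.
move=> SM; pose s := flatten [seq nseq (M c) c | c <- enum T].
have szs : size s = n.
  rewrite size_flatten /shape -map_comp (eq_map (g := M)); last first.
    by move=> c /=; rewrite size_nseq.
  by rewrite sumnE big_map big_enum.
have cs c : count_mem c s = M c.
  rewrite count_flatten -map_comp sumnE big_map big_enum /= (bigD1 c) //=.
  rewrite count_nseq /= eqxx mul1n big1 ?addn0 // => d /negPf dc.
  by rewrite count_nseq /= dc mul0n.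
exists [ffun i => tnth (Tuple (introT eqP szs)) i]; apply/ffunP=> c.
rewrite fibreE -cs; congr (count_mem c _); rewrite -[RHS]/(tval (Tuple (introT eqP szs))).
by congr tval; apply/eq_from_tnth => i; rewrite tnth_mktuple ffunE.
Qed.

(** The permutations that carry F to H form a coset of the stabilizer. *)
Lemma card_transporter F H : fibre F = fibre H ->
  #|[set s | recolour s F == H]| = #|[set s | fixes s F]|.
Proof.
case/fibre_eq_recolour=> t ->.
rewrite -[RHS](card_imset _ (@mulgI _ t)); apply: eq_card => s.
rewrite !inE; apply/eqP/imsetP => [sF|[u]].
  exists (t^-1 * s)%g; last by rewrite mulKVg.
  rewrite inE; apply/fixesP/ffunP=> i; rewrite ffunE permM.
  have /ffunP/(_ (t^-1 i)%g) := sF.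
  by rewrite !ffunE permKV.
rewrite inE => /fixesP uF ->; apply/ffunP=> i; rewrite !ffunE permM.
by rewrite -{2}uF ffunE.
Qed.

Lemma card_stab_fibre F H : fibre F = fibre H ->
  #|[set s | fixes s F]| = #|[set s | fixes s H]|.
Proof.
move=> FH; rewrite -(card_transporter FH) -(card_transporter (esym FH)).
rewrite -[LHS](card_imset _ (@invg_inj _)); apply: eq_card => s.
apply/imsetP/idP => [[u]|]; rewrite !inE.
  move=> /eqP <- ->; apply/eqP/ffunP=> i; rewrite !ffunE permKV //.
move=> /eqP <-; exists s^-1%g; rewrite ?invgK // inE.
by apply/eqP/ffunP=> i; rewrite !ffunE permKV.
Qed.

(** The colourings with given multiplicities form a single orbit, over which
    the orders of the stabilizers add up to the order of the group. *)
Lemma sum_card_stab (M : {ffun T -> nat}) : (\sum_c M c = n)%N ->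
  (\sum_(F | fibre F == M) #|[set s | fixes s F]| = n`!)%N.
Proof.
case/exists_fibre=> F0 F0M; rewrite -card_Sn -sum1_card.
rewrite (partition_big (recolour^~ F0) (fun F => fibre F == M)) => [|s _] /=;
  last by rewrite fibre_recolour F0M.
apply: eq_bigr => F /eqP FM; have F0F : fibre F0 = fibre F by rewrite F0M.
by rewrite sum1dep_card (card_transporter F0F) (card_stab_fibre F0F).
Qed.

(** Burnside's lemma, weighted by a function of the orbit; the orbits of
    colourings are labelled by the multiplicities of the colours. *)
Lemma sum_fixes (w : {ffun T -> nat} -> algC) :
  \sum_(s : 'S_n) \sum_(F | fixes s F) w (fibre F) =
  n`!%:R * \sum_(M : {ffun T -> 'I_n.+1} | (\sum_c M c == n)%N)
      w [ffun c => M c : nat].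
Proof.
rewrite (exchange_big_dep predT) //=.
pose fib F : {ffun T -> 'I_n.+1} := [ffun c => inord (fibre F c)].
have fibK F : [ffun c => fib F c : nat] = fibre F.
  apply/ffunP=> c; rewrite !ffunE inordK // ltnS -[X in (_ <= X)%N]card_ord.
  exact: max_card.
rewrite (partition_big fib (fun M => (\sum_c M c == n)%N)) => [|F _] /=; last first.
  rewrite -[X in _ == X](sum_fibre F) (eq_bigr (fibre F)) // => c _.
  by rewrite -fibK ffunE.
rewrite mulr_sumr; apply: eq_bigr => M /eqP SM.
rewrite -(sum_card_stab (M := [ffun c => M c : nat])); last first.
  by rewrite -[RHS]SM; apply: eq_bigr => c _; rewrite ffunE.
rewrite natr_sum mulr_suml; apply: eq_big => F.
  apply/eqP/eqP => [<-|FM]; first by rewrite fibK.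
  by apply/ffunP=> c; rewrite ffunE FM ffunE inord_val.
move=> /eqP<-; rewrite fibK sumr_const mulr_natl; congr (_ *+ _).
by apply: eq_card => s; rewrite !inE.
Qed.

End Colouring.

(** * Alternating sums of permutation characters *)

Section Characters.
Variables (n N : nat).
Implicit Types (F : {ffun 'I_n -> 'I_N}) (s : 'S_n) (x y alpha : 'rV[int]_N).

Definition weight F : 'rV[int]_N := content id (fibre F).

Lemma weightE F i : weight F 0 i = (fibre F i)%:Z.
Proof. by rewrite contentE big_pred1_eq. Qed.

Lemma content_fibre (T : finType) (w : T -> 'I_N) (H : {ffun 'I_n -> T}) :
  content w (fibre H) = weight [ffun i => w (H i)].
Proof.
apply/rowP=> a; rewrite weightE contentE; congr _%:Z; rewrite ffunE -sum1_card.
rewrite (partition_big H (fun c => w c == a)) => [|i]; last by rewrite inE ffunE.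
apply: eq_bigr => c /eqP ca; rewrite ffunE -sum1_card; apply: eq_bigl => i.
by rewrite !inE andb_idl // => /eqP Hi; rewrite ffunE Hi ca.
Qed.

Lemma weight_inj F H : weight F = weight H -> fibre F = fibre H.
Proof.
by move=> FH; apply/ffunP=> i; have := weightE F i; rewrite FH weightE => -[].
Qed.

Lemma sum_weight F : \sum_i weight F 0 i = n%:Z.
Proof.
rewrite -[in RHS](sum_fibre F) -[RHS]natz natr_sum.
by apply: eq_bigr => i _; rewrite weightE natz.
Qed.

Lemma fixes_conj (T : finType) (F : {ffun 'I_n -> T}) s t :
  fixes (s ^ t)%g F = fixes s (recolour t F).
Proof.
apply/forallP/forallP => h i.
  by have := h (t i); rewrite !ffunE conjgE !permM permK.
by have := h (t^-1 i)%g; rewrite !ffunE conjgE !permM permKV.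
Qed.

Lemma fiber_stabE (f : 'I_n -> nat) F s :
  (forall i, f i = F i) -> (s \in fiber_stab f) = fixes s F.
Proof. by move=> fF; rewrite inE; apply: eq_forallb => i; rewrite !fF. Qed.

(** Induction from a stabilizer gives the permutation character of the orbit. *)
Lemma induced_trivialE (f : 'I_n -> nat) F s : (forall i, f i = F i) ->
  'Ind[[set: 'S_n], fiber_stab_group f] 1 s =
  (#|[set H | fixes s H & weight H == weight F]|)%:R.
Proof.
move=> fF; rewrite cfIndE ?subsetT //.
have inG u : (u \in fiber_stab_group f) = fixes u F := fiber_stabE u fF.
have cardG : #|fiber_stab_group f| = #|[set u | fixes u F]|.
  by apply: eq_card => u; rewrite inG inE.
have F0 : #|fiber_stab_group f|%:R != 0 :> algC by rewrite pnatr_eq0 -lt0n cardG_gt0.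
apply: (mulfI F0); rewrite mulVKf //.
under eq_bigr do rewrite cfun1E inG fixes_conj.
rewrite (partition_big (fun t => recolour t F) (fun H => weight H == weight F)) => [|t _] /=;
  last by rewrite /weight fibre_recolour.
rewrite -natrM mulnC -sum_nat_const natr_sum big_mkcond [RHS]big_mkcond /=.
apply: eq_bigr => H _; rewrite inE andbC; case: eqP => //= FH.
rewrite (eq_bigr (fun=> (fixes s H)%:R)) => [|t /andP[_ /eqP-> //]].
rewrite sumr_const; case: (fixes s H); last by rewrite mul0rn.
rewrite cardG -(card_transporter (weight_inj (esym FH))); congr _%:R.
by apply: eq_card => t; rewrite [in LHS]unfold_in !inE.
Qed.

(** The permutation character on the colourings of weight alpha. It is given as
    an induced character, so that it is visibly a character; it vanishes if
    alpha has a negative entry. *)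
Definition orbit_character alpha : 'CF([set: 'S_n]) :=
  if [pick F | weight F == alpha] is Some F
  then 'Ind[[set: 'S_n], fiber_stab_group (fun i => F i : nat)] 1 else 0.

Lemma orbit_characterE alpha s :
  orbit_character alpha s = (#|[set H | fixes s H & weight H == alpha]|)%:R.
Proof.
rewrite /orbit_character; case: pickP => [F /eqP <-|nF].
  exact: induced_trivialE.
rewrite cfunE (_ : [set _ | _ & _] = set0) ?cards0 //.
by apply/setP=> H; rewrite !inE nF andbF.
Qed.

Lemma orbit_character_char alpha : orbit_character alpha \is a character.
Proof.
rewrite /orbit_character; case: pickP => [F _|_]; last exact: rpred0.
by rewrite cfInd_char // cfun1_char.
Qed.

Lemma induced_trivial_orbit (f : 'I_n -> nat) F : (forall i, f i = F i) ->
  'Ind[[set: 'S_n], fiber_stab_group f] 1 = orbit_character (weight F).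
Proof. by move=> fF; apply/cfunP=> s; rewrite (induced_trivialE _ fF) orbit_characterE. Qed.

(** The expanded Jacobi-Trudi determinant of lambda, for entries
    x_i = lambda_i - i - 1: the orbit characters correspond to products of
    complete symmetric functions. *)
Definition jacobi_trudi x : 'CF([set: 'S_n]) :=
  \sum_(w : 'S_N) (-1) ^+ odd_perm w *: orbit_character (x - col_perm w (vac N)).

Lemma pairing_vacE x : pairing x (vac N) =
  \sum_(w : 'S_N) (-1) ^+ odd_perm w * (x == col_perm w (vac N))%:R.
Proof.
apply: eq_bigr => w _; congr (_ * _).
under eq_bigr do rewrite mxE; case: eqP => [->|xw].
  by rewrite big1 // => i _; rewrite mxE eqxx.
apply/eqP; rewrite prodf_seq_eq0 /=.
have [/forallP xE|/forallPn[i xi]] := boolP [forall i, x 0 i == vac N 0 (w i)].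
  by case: xw; apply/rowP=> i; rewrite [RHS]mxE; apply/eqP.
by apply/hasP; exists i; rewrite ?mem_index_enum // (negPf xi).
Qed.

Lemma jacobi_trudiE x s :
  jacobi_trudi x s = \sum_(F | fixes s F) pairing (x - weight F) (vac N).
Proof.
rewrite sum_cfunE; under [RHS]eq_bigr do rewrite pairing_vacE.
rewrite exchange_big; apply: eq_bigr => w _ /=.
rewrite cfunE orbit_characterE -mulr_sumr; congr (_ * _).
rewrite -natr_sum -sum1_card; congr _%:R; rewrite big_mkcond [RHS]big_mkcond /=.
apply: eq_bigr => F _; rewrite inE; case: fixes => //=.
by rewrite [weight F == _]eq_sym !subr_eq addrC; case: eqP.
Qed.

Lemma jacobi_trudi_vchar x : jacobi_trudi x \in 'Z[irr [set: 'S_n]]%g.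
Proof.
apply: rpred_sum => w _; rewrite rpredZsign.
exact/char_vchar/orbit_character_char.
Qed.

Lemma conj_pairing x y : (pairing x y)^* = pairing x y.
Proof.
rewrite /pairing -det_map_mx; congr (\det _); apply/matrixP=> i j.
by rewrite !mxE rmorph_nat.
Qed.

(** A pair of colourings is one colouring by pairs of colours, and its
    multiplicities form a matrix whose margins are the two weights. *)
Lemma cfdot_jacobi_trudi x y : '[jacobi_trudi x, jacobi_trudi y] = cauchy_sum n n x y.
Proof.
have n0 : n`!%:R != 0 :> algC by rewrite pnatr_eq0 -lt0n fact_gt0.
rewrite cfdotE cardsT card_Sn; apply: (mulfI n0); rewrite mulVKf //.
pose w (M : {ffun 'I_N * 'I_N -> nat}) : algC :=
  pairing (x - content fst M) (vac N) * pairing (y - content snd M) (vac N).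
rewrite -[RHS](sum_fixes n w).
apply: eq_big => [s|s _]; first by rewrite inE.
rewrite !jacobi_trudiE rmorph_sum /= mulr_suml.
under [LHS]eq_bigr do rewrite mulr_sumr.
rewrite pair_big /=.
pose h (p : {ffun 'I_n -> 'I_N} * {ffun 'I_n -> 'I_N}) := [ffun i => (p.1 i, p.2 i)].
pose h' (H : {ffun 'I_n -> 'I_N * 'I_N}) := ([ffun i => (H i).1], [ffun i => (H i).2]).
rewrite (reindex h) /=; last first.
  exists h' => [[F G] _|H _]; rewrite /h /h' /=.
    by congr (_, _); apply/ffunP=> i; rewrite !ffunE.
  by apply/ffunP=> i; rewrite !ffunE /=; case: (H i).
apply: eq_big => [[F G]|[F G] _] /=.
  apply/andP/forallP => [[/forallP sF /forallP sG] i|h0].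
    by rewrite !ffunE /= (eqP (sF i)) (eqP (sG i)).
  by split; apply/forallP=> i; have := h0 i; rewrite !ffunE => /eqP[/eqP ? /eqP].
rewrite /w; have -> : content fst (fibre (h (F, G))) = weight F.
  by rewrite content_fibre; congr weight; apply/ffunP=> i; rewrite !ffunE.
have -> : content snd (fibre (h (F, G))) = weight G.
  by rewrite content_fibre; congr weight; apply/ffunP=> i; rewrite !ffunE.
by rewrite conj_pairing.
Qed.

End Characters.

(** * The common constituent of a Young diagram *)

Section SignCharacter.
Variables (n : nat) (G : {group 'S_n}).

Definition sign_mx (s : 'S_n) : 'M[algC]_1 := ((-1) ^+ odd_perm s)%:M.

Lemma sign_mx_repr : mx_repr G sign_mx.
Proof.
split=> [|s t _ _]; first by rewrite /sign_mx odd_perm1.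
by rewrite /sign_mx odd_permM signr_addb scalar_mxM.
Qed.

Lemma sign_cfunE s : sign_cfun G s = (-1) ^+ odd_perm s *+ (s \in G).
Proof. by rewrite cfunElock. Qed.

Lemma sign_cfun_char : sign_cfun G \is a character.
Proof.
have -> : sign_cfun G = cfRepr (MxRepresentation sign_mx_repr).
  apply/cfunP=> s; rewrite sign_cfunE [RHS]cfunE /=; case: (s \in G) => //=.
  by rewrite mxtrace_scalar.
exact: cfRepr_char.
Qed.

End SignCharacter.

Section Young.
Variables (n N K : nat) (row : {ffun 'I_n -> 'I_N}) (col : {ffun 'I_n -> 'I_K}).
Implicit Types (F : {ffun 'I_n -> 'I_N}) (s : 'S_n) (alpha : 'rV[int]_N).

Definition separated F := [forall i, forall j, (F i == F j) && (col i == col j) ==> (i == j)].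

Lemma separatedP F :
  reflect (forall i j, F i = F j -> col i = col j -> i = j) (separated F).
Proof.
apply: (iffP forallP) => [h i j Fij cij|h i].
  by have /forallP/(_ j) := h i; rewrite Fij cij !eqxx /= => /eqP.
by apply/forallP => j; apply/implyP => /andP[/eqP Fij /eqP cij]; apply/eqP/h.
Qed.

Variable colstab : {group 'S_n}.
Hypothesis colstabP : forall s, (s \in colstab) = fixes s col.

(** If two points of a column share a colour, their transposition lies in the
    group of the sum and pairs its even elements with its odd ones; otherwise
    that group is trivial. *)
Lemma sum_sign_stab F :
  \sum_(s in colstab | fixes s F) (-1) ^+ odd_perm s = (separated F)%:R :> algC.
Proof.
have [/separatedP sepF|] := boolP (separated F).
  rewrite (big_pred1 1%g) ?odd_perm1 // => s /=; rewrite colstabP.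
  apply/andP/eqP => [[/forallP sc /forallP sF]|->].
    by apply/permP=> i; rewrite perm1; apply: sepF; apply/eqP.
  by split; apply/forallP=> i; rewrite perm1.
rewrite negb_forall => /fintype.existsP[i]; rewrite negb_forall => /fintype.existsP[j].
rewrite negb_imply => /andP[/andP[/eqP Fij /eqP cij] nij].
have tF (T : finType) (H : {ffun 'I_n -> T}) s : H i = H j ->
    fixes (tperm i j * s)%g H = fixes s H.
  move=> Hij; apply/forallP/forallP => h k.
    have := h (tperm i j k); rewrite permM tpermK => /eqP->; apply/eqP.
    by case: tpermP => [->|->|].
  by rewrite permM (eqP (h _)); apply/eqP; case: tpermP => [->|->|].
set S := \sum_(s in _ | _) _; suff : S = - S.
  by move/eqP; rewrite -addr_eq0 -mulr2n mulrn_eq0 /= => /eqP.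
rewrite {1}/S (reindex_inj (mulgI (tperm i j))) /= -sumrN; apply: eq_big => s.
  by rewrite !colstabP !tF.
by rewrite odd_permM odd_tperm nij /= => _; rewrite signrN.
Qed.

Definition ind_sign : 'CF([set: 'S_n]) := 'Ind[[set: 'S_n]] (sign_cfun colstab).

Lemma ind_sign_char : ind_sign \is a character.
Proof. exact/cfInd_char/sign_cfun_char. Qed.

Lemma cfdot_orbit_sign alpha : '[orbit_character n alpha, ind_sign] =
  #|[set F | separated F & weight F == alpha]|%:R / #|colstab|%:R.
Proof.
rewrite /ind_sign -cfdot_Res_l cfdotE mulrC; congr (_ / _).
transitivity (\sum_(s in colstab) \sum_(F | fixes s F && (weight F == alpha))
   (-1) ^+ odd_perm s : algC).
  apply: eq_bigr => s sC; rewrite cfResE ?finset.subsetT // orbit_characterE.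
  rewrite sign_cfunE sC rmorph_sign sumr_const mulr_natl; congr (_ *+ _).
  by apply: eq_card => F; rewrite !inE.
rewrite (exchange_big_dep (fun F => weight F == alpha)) /=; last by move=> s F _ /andP[].
rewrite -sum1_card natr_sum big_mkcond [RHS]big_mkcond /=; apply: eq_bigr => F _.
rewrite inE andbC; case: eqP => //= Fa.
transitivity ((separated F)%:R : algC); last by case: separated.
by rewrite -sum_sign_stab; apply: eq_bigl => s; rewrite andbT.
Qed.

(* The points are the cells of a Young diagram. *)
Hypothesis row_separated : separated row.
Hypothesis row_closed : forall i (r : 'I_N), (r <= row i)%N ->
  exists2 j, row j = r & col j = col i.

Definition above F (r : nat) c := [set i | (F i < r)%N && (col i == c)].

(** In column c either all the cells are in the rows before r, or the rows
    before r all meet column c; at most r cells of a column can have colours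
    smaller than r. *)
Lemma leq_card_above F r c : separated F ->
  (#|above F r c| <= #|above row r c|)%N.
Proof.
move=> /separatedP sepF.
have [/fintype.existsP[i0 /andP[/eqP ci0 r_le]]|] :=
    boolP [exists i, (col i == c) && (r <= row i)%N]; last first.
  rewrite negb_exists => /forallP nex; apply/subset_leq_card/fintype.subsetP => i.
  rewrite !inE => /andP[_ ci]; rewrite ci andbT.
  by have := nex i; rewrite ci /= -ltnNge.
have <- : #|F @: above F r c| = #|above F r c|.
  apply: card_in_imset => i j; rewrite !inE => /andP[_ /eqP ci] /andP[_ /eqP cj] Fij.
  by apply: sepF; rewrite // ci cj.
apply: leq_trans (leq_imset_card row _); apply/subset_leq_card/fintype.subsetP => k.
case/imsetP=> i; rewrite inE => /andP[Fi _] kE.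
have [|j rj cj] := @row_closed i0 k; first by rewrite kE; exact: leq_trans (ltnW Fi) r_le.
by apply/imsetP; exists j; rewrite // inE rj kE Fi cj ci0 eqxx.
Qed.

Lemma sum_card_above F r :
  (\sum_c #|above F r c| = \sum_(k < N | (k < r)%N) fibre F k)%N.
Proof.
transitivity #|[set i | (F i < r)%N]|.
  rewrite -[RHS]sum1_card (partition_big col predT) //=; apply: eq_bigr => c _.
  by rewrite -sum1_card; apply: eq_bigl => i; rewrite !inE.
rewrite -[LHS]sum1_card (partition_big F (fun k : 'I_N => (k < r)%N)) => [|i] /=;
  last by rewrite inE.
apply: eq_bigr => k kr; rewrite ffunE -sum1_card; apply: eq_bigl => i.
by rewrite !inE andb_idl // => /eqP->.
Qed.

(** Dominance: summing [leq_card_above] over the columns bounds the partial sums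
    of the weight by those of the diagram, whereas w can only increase them. *)
Lemma separated_weight F (w : 'S_N) : separated F ->
  weight F = weight row + vac N - col_perm w (vac N) -> w = 1%g.
Proof.
move=> sepF wF.
have fE k : (fibre F k + k = fibre row k + w k)%N.
  have := weightE F k; rewrite wF; have := weightE row k.
  by rewrite !mxE; set u := fun_of_matrix _ _ _; move=> -> /=; lia.
have le_r r : (\sum_(k < N | (k < r)%N) w k <= \sum_(k < N | (k < r)%N) k)%N.
  rewrite -(leq_add2l (\sum_(k < N | (k < r)%N) fibre row k)) -big_split /=.
  under eq_bigr do rewrite -fE; rewrite big_split /= leq_add2r -!sum_card_above.
  by apply: leq_sum => c _; apply: leq_card_above.
suff H r : forall k : 'I_N, (k < r)%N -> w k = k.
  by apply/permP=> k; rewrite perm1; apply: (H N).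
elim: r => [//|r IH] k; rewrite ltnS leq_eqVlt => /orP[/eqP kr|/IH //].
have := le_r r.+1; rewrite (bigD1 k) ?[X in (_ <= X)%N](bigD1 k) /= ?kr ?ltnSn //.
rewrite (eq_bigr (fun k : 'I_N => k : nat)) => [|j /andP[jr jk]]; last first.
  by rewrite IH // ltn_neqAle -ltnS jr andbT -kr.
rewrite leq_add2r leq_eqVlt => /orP[/eqP wk|wk].
  by apply/val_inj; rewrite /= wk kr.
by have := IH _ wk => /perm_inj.
Qed.

(** With equality in [leq_card_above] everywhere, the pairs (F, col) and
    (row, col) have the same multiplicities, so that a permutation maps one to
    the other; it preserves columns. *)
Lemma separated_recolour F : separated F -> weight F = weight row ->
  exists2 s, s \in colstab & F = recolour s row.
Proof.
move=> sepF /weight_inj Ff.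
(* The totals over the columns agree and the terms are ordered. *)
have ab r c : #|above F r c| = #|above row r c|.
  have E : (\sum_c (#|above row r c| - #|above F r c|) == 0)%N.
    rewrite sumnB => [|d _]; last exact: leq_card_above.
    by rewrite !sum_card_above Ff subnn.
  move: E; rewrite sum_nat_eq0 => /forallP/(_ c) /=; rewrite subn_eq0 => E.
  by apply/eqP; rewrite eqn_leq E leq_card_above.
pose joint H := [ffun i => (H i, col i)] : {ffun 'I_n -> 'I_N * 'I_K}.
have split H r c : #|above H r.+1 c| =
    (#|above H r c| + #|[set i | (H i == r :> nat) && (col i == c)]|)%N.
  rewrite -cardsUI (_ : _ :&: _ = finset.set0) ?cards0 ?addn0.
    by apply: eq_card => i; rewrite !inE ltnS leq_eqVlt -andb_orl orbC.
  by apply/setP=> i; rewrite !inE; case: ltngtP => //=; rewrite ?andbF.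
have [|s sE] := @fibre_eq_recolour _ _ (joint row) (joint F).
  apply/ffunP=> -[r c]; rewrite !ffunE.
  have jE H : #|[set i | joint H i == (r, c)]| =
      #|[set i | (H i == r :> nat) && (col i == c)]|.
    by apply: eq_card => i; rewrite !inE ffunE.
  have := split F r c; rewrite ab split ab => /addnI.
  by rewrite !jE.
exists s.
  rewrite colstabP; apply/forallP=> i; have /ffunP/(_ i) := sE.
  by rewrite !ffunE => -[_ ->].
by apply/ffunP=> i; have /ffunP/(_ i) := sE; rewrite !ffunE => -[->].
Qed.

Lemma cfdot_orbit_row_sign : '[orbit_character n (weight row), ind_sign] = 1.
Proof.
rewrite cfdot_orbit_sign; set A := [set _ | _ & _].
suff -> : A = [set recolour s row | s in colstab].
  rewrite card_in_imset ?divff ?pnatr_eq0 -?lt0n ?cardG_gt0 //.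
  move=> s t; rewrite !colstabP => /forallP sC /forallP tC st.
  apply/permP=> i; apply: (separatedP _ row_separated).
    by have /ffunP/(_ i) := st; rewrite !ffunE.
  by rewrite (eqP (sC i)) (eqP (tC i)).
apply/setP=> F; rewrite inE; apply/andP/imsetP => [[sF /eqP wF]|[s sC ->]].
  by have [s sC ->] := separated_recolour sF wF; exists s.
rewrite /weight fibre_recolour eqxx; split=> //.
apply/separatedP=> i j; rewrite !ffunE => rij cij.
apply: (@perm_inj _ s); apply: (separatedP _ row_separated) => //.
by move: sC; rewrite colstabP => /forallP sC; rewrite (eqP (sC i)) (eqP (sC j)).
Qed.

Let x := weight row + vac N.
Hypothesis x_inj : injective (x 0).

Lemma cfdot_orbit_shift_sign (w : 'S_N) : w != 1%g ->
  '[orbit_character n (x - col_perm w (vac N)), ind_sign] = 0.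
Proof.
move=> w1; rewrite cfdot_orbit_sign; set A := [set _ | _ & _].
suff -> : A = finset.set0 by rewrite cards0 mul0r.
apply/setP=> F; rewrite !inE; apply/andP=> -[sF /eqP wF].
by case/eqP: w1; apply: separated_weight sF wF.
Qed.

Lemma jacobi_trudi_norm : '[jacobi_trudi n x] = 1.
Proof.
rewrite cfdot_jacobi_trudi cauchy_sumE ?pairing_refl // => [i|].
  by rewrite mxE weightE mxE; have := ltn_ord i; lia.
under eq_bigr do rewrite mxE.
by rewrite big_split /= sum_weight addrC.
Qed.

(** Inner products of characters are sums of nonnegative terms, one for each
    irreducible character. *)
Lemma cfdot_char_eq0 (phi psi : 'CF([set: 'S_n])) i : phi \is a character ->
  psi \is a character -> '[phi, psi] = 0 -> '[psi, 'chi_i] != 0 -> '[phi, 'chi_i] = 0.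
Proof.
move=> ch1 ch2; rewrite cfdot_char_r // => /eqP; rewrite psumr_eq0 => [|k _]; last first.
  by rewrite mulr_ge0 // natr_ge0 // Cnat_cfdot_char_irr.
by move/allP/(_ i); rewrite mem_index_enum mulf_eq0 => /(_ isT) /orP[/eqP|-> //].
Qed.

(** The norm is 1, so that the alternating sum is an irreducible character up to
    sign. Only the term w = 1 meets the induced sign character, and it does so
    once: this fixes the sign, makes the irreducible character a constituent of
    both, and excludes any other common constituent. *)
Lemma jacobi_trudi_common_constituent :
  (if [pick i | (i \in irr_constt (orbit_character n (weight row))) &&
                (i \in irr_constt ind_sign)]
   is Some i then 'chi_i else 0) = jacobi_trudi n x.
Proof.
have row_char := orbit_character_char n (weight row).
have xE : x - col_perm 1 (vac N) = weight row by rewrite col_perm1 addrK.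
have jacobi_trudi_eps : '[jacobi_trudi n x, ind_sign] = 1.
  rewrite cfdot_suml (bigD1 1%g) //= odd_perm1 scale1r xE cfdot_orbit_row_sign.
  rewrite big1 ?addr0 // => w w1.
  by rewrite cfdotZl cfdot_orbit_shift_sign ?mulr0.
have [b [i slE]] := vchar_norm1P (jacobi_trudi_vchar n x) jacobi_trudi_norm.
have /eqP := jacobi_trudi_eps; rewrite slE cfdotZl cfdotC_char ?irr_char ?ind_sign_char //.
move=> eps_i.
have ei0 : '[ind_sign, 'chi_i] != 0.
  by apply: contraTneq eps_i => ->; rewrite mulr0 eq_sym oner_eq0.
have b0 : b = false.
  apply: contraTF eps_i => ->; rewrite expr1 mulN1r eqr_oppLR.
  apply: contraTneq (natr_ge0 (Cnat_cfdot_char_irr i ind_sign_char)) => ->.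
  by rewrite oppr_ge0 ler10.
rewrite b0 scale1r in slE; rewrite b0 mul1r in eps_i.
have row_i : '[orbit_character n (weight row), 'chi_i] = 1.
  rewrite -jacobi_trudi_norm {2}slE cfdot_suml (bigD1 1%g) //= odd_perm1 scale1r xE.
  rewrite big1 ?addr0 // => w w1; rewrite cfdotZl.
  rewrite (cfdot_char_eq0 (orbit_character_char _ _) ind_sign_char) ?mulr0 //.
  exact: cfdot_orbit_shift_sign.
have prodN k : true -> '[orbit_character n (weight row), 'chi_k] * '[ind_sign, 'chi_k] \in Num.nat.
  by move=> _; rewrite rpredM // Cnat_cfdot_char_irr // ind_sign_char.
have := cfdot_orbit_row_sign; rewrite cfdot_char_r ?ind_sign_char //.
case/(natr_sum_eq1 prodN) => j [_ _ j0].
have common k : (k \in irr_constt (orbit_character n (weight row))) &&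
    (k \in irr_constt ind_sign) -> k = j.
  rewrite !irr_consttE => /andP[rk ek]; apply/eqP; apply: contraT => kj.
  by have /eqP := j0 _ kj isT; rewrite mulf_eq0 (negPf rk) (negPf ek).
have iP : (i \in irr_constt (orbit_character n (weight row))) && (i \in irr_constt ind_sign).
  by rewrite !irr_consttE row_i oner_eq0.
case: pickP => [k /common ->|/(_ i)]; last by rewrite iP.
by rewrite -(common _ iP) b0 scale1r.
Qed.

End Young.

Lemma card_row (lambda : seq nat) (k : nat) :
  #|[set i : 'I_(sumn lambda) | reshape_index lambda i == k]| = nth 0%N lambda k.
Proof.
pose h (c : 'I_(nth 0%N lambda k)) : 'I_(sumn lambda) := Ordinal (flatten_indexP (ltn_ord c)).
have hI : injective h.
  by move=> c d /(congr1 val) /addnI /val_inj.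
rewrite -[RHS]card_ord -(card_imset _ hI); apply: eq_card => i; rewrite inE.
apply/eqP/imsetP => [ik|[c _ ->]]; last exact: flatten_indexKl.
have oN : (reshape_offset lambda i < nth 0 lambda k)%N.
  by rewrite -ik; apply: reshape_offsetP.
by exists (Ordinal oN) => //; apply/val_inj; rewrite /= -[LHS](reshape_indexK lambda) ik.
Qed.

(** The rows and columns of the tableau filled row by row are an instance of
    the situation above. *)
Lemma irr_sym_jacobi_trudi N (lambda : seq nat) (x : 'rV[int]_N) :
    sorted geq lambda -> (size lambda <= N)%N ->
    (forall i : 'I_N, x 0 i = (nth 0%N lambda i)%:Z - (i.+1)%:Z) ->
  irr_sym lambda = jacobi_trudi (sumn lambda) x.
Proof.
move=> l_sort szl xE.
have nth_le i j : (i <= j)%N -> (nth 0 lambda j <= nth 0 lambda i)%N.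
  have [jl|jl] := ltnP j (size lambda); last by rewrite (nth_default _ jl).
  have geq_tr : transitive geq by move=> a b c /= ab ca; exact: leq_trans ca ab.
  have geq_refl : reflexive geq by move=> a /=.
  move=> ij; apply: (sorted_leq_nth geq_tr geq_refl 0%N l_sort) => //.
  exact: leq_ltn_trans jl.
pose row := [ffun i : 'I_(sumn lambda) =>
  widen_ord szl (Ordinal (reshape_indexP (ltn_ord i)))].
have offP (i : 'I_(sumn lambda)) : (reshape_offset lambda i < sumn lambda)%N.
  exact: leq_ltn_trans (leq_subr _ _) (ltn_ord i).
pose col := [ffun i : 'I_(sumn lambda) => Ordinal (offP i)].
have rowE (i : 'I_(sumn lambda)) : reshape_index lambda i = row i by rewrite ffunE.
have colE (i : 'I_(sumn lambda)) : reshape_offset lambda i = col i by rewrite ffunE.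
have weightx : x = weight row + vac N.
  apply/rowP=> i; rewrite xE mxE weightE mxE ffunE; congr (_%:Z - _).
  by rewrite -card_row; apply: eq_card => j; rewrite !inE rowE.
rewrite /irr_sym /= (induced_trivial_orbit rowE) weightx.
apply: (@jacobi_trudi_common_constituent _ _ _ row col).
- by move=> s; apply: fiber_stabE.
- apply/separatedP=> i j rij cij; apply/val_inj.
  by rewrite /= -(reshape_indexK lambda i) -(reshape_indexK lambda j) !rowE !colE rij cij.
- move=> i r ri.
  have co : (reshape_offset lambda i < nth 0 lambda r)%N.
    apply: leq_trans (reshape_offsetP (ltn_ord i)) _.
    by apply: nth_le; rewrite rowE.
  exists (Ordinal (flatten_indexP co)); apply/val_inj; rewrite /=.
    by rewrite -rowE /=; apply: flatten_indexKl.
  by rewrite -!colE /=; apply: flatten_indexKr.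
- rewrite -weightx => i j; rewrite !xE => ij; apply/val_inj => /=.
  by have := nth_le i j; have := nth_le j i; case: (ltngtP i j); lia.
Qed.

(** * The Murnaghan-Nakayama rule *)

Section MurnaghanNakayama.
Variable N : nat.
Implicit Types x : 'rV[int]_N.

(** The vacuum coefficient of P_(nu_1) P_(nu_2) ... on the wedge of x. Lowering
    an entry removes a rim hook, the sign being that of sorting the result, or
    gives zero when two entries collide. *)
Fixpoint mn_sum (nu : seq nat) x : algC :=
  if nu is k :: nu' then \sum_i mn_sum nu' (raise (- k%:Z) i x)
  else pairing x (vac N).

Lemma mn_sum_cons_cat s1 k s2 x : mn_sum (s1 ++ k :: s2) x = mn_sum (k :: s1 ++ s2) x.
Proof.
elim: s1 x => [//|a s1 IH] x /=.
under eq_bigr do rewrite IH /=.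
rewrite exchange_big; apply: eq_bigr => i _; apply: eq_bigr => j _.
by rewrite raiseC.
Qed.

Lemma mn_sum_perm nu1 nu2 x : perm_eq nu1 nu2 -> mn_sum nu1 x = mn_sum nu2 x.
Proof.
elim: nu1 nu2 x => [|k s IH] nu2 x; first by rewrite perm_sym => /perm_nilP ->.
move=> p; have k2 : k \in nu2 by rewrite -(perm_mem p) mem_head.
case/splitPr: k2 p => s1 s2 p.
rewrite mn_sum_cons_cat /=; apply: eq_bigr => i _; apply: IH.
by rewrite -(perm_cons k) (perm_trans p) // -[k :: s2]cat1s perm_catCA.
Qed.

(** Unfolding the recursion chooses for each part the entry that it lowers. *)
Lemma mn_sum_ffun k (wt : 'I_k -> nat) x :
  mn_sum [seq wt c | c : 'I_k] x =
  \sum_(g : {ffun 'I_k -> 'I_N}) pairing (x - content g [ffun c => wt c]) (vac N).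
Proof.
elim: k wt x => [|k IH] wt x.
  rewrite /image_mem enum_ord0 /= (big_pred1 (ffun0 (card_ord 0))).
    by rewrite /content big_ord0 subr0.
  by move=> g; apply/esym/eqP/ffunP=> -[].
rewrite /image_mem enum_ordSl /= -map_comp.
pose h (p : 'I_N * {ffun 'I_k -> 'I_N}) :=
  [ffun c => if unlift ord0 c is Some c' then p.2 c' else p.1].
rewrite (reindex h) /=; last first.
  exists (fun g : {ffun 'I_k.+1 -> 'I_N} =>
    (g ord0, [ffun c => g (fintype.lift ord0 c)])) => [[i g] _|g _] /=.
    congr (_, _); first by rewrite ffunE unlift_none.
    by apply/ffunP=> c; rewrite !ffunE liftK.
  by apply/ffunP=> c; rewrite ffunE; case: unliftP => [c' ->|->]; rewrite ?ffunE.
rewrite -(pair_bigA _ (fun i g => pairing (x - content (h (i, g)) [ffun c => wt c]) (vac N))) /=.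
apply: eq_bigr => i _; rewrite [LHS](IH (wt \o fintype.lift ord0)); apply: eq_bigr => g _.
congr (pairing _ _); rewrite /content big_ord_recl /= !ffunE unlift_none /=.
rewrite /raise scaleNr opprD addrA; congr (_ - _).
by apply: eq_bigr => c _; rewrite !ffunE liftK.
Qed.

Lemma mn_sum_neq0 nu x : mn_sum nu x != 0 ->
  (forall i, 0 <= x 0 i + N%:Z) /\ \sum_i x 0 i = \sum_i vac N 0 i + (sumn nu)%:Z.
Proof.
elim: nu x => [|k nu IH] x /=.
  rewrite pairing_vacE => D; have [w xw] : exists w, x = col_perm w (vac N).
    have [/fintype.existsP[w /eqP xw]|] := boolP [exists w, x == col_perm w (vac N)].
      by exists w.
    rewrite negb_exists => /forallP nx; case/eqP: D; apply: big1 => w _.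
    by rewrite (negPf (nx w)) mulr0.
  split=> [i|]; first by rewrite xw mxE mxE; have := ltn_ord (w i); lia.
  rewrite addr0 [RHS](reindex_inj (@perm_inj _ w)) xw.
  by apply: eq_bigr => i _; rewrite mxE.
move=> D; have [i /IH[ge0 S]] : exists i, mn_sum nu (raise (- k%:Z) i x) != 0.
  apply/fintype.existsP; apply: contraNT D => /fintype.existsPn nx.
  by rewrite big1 // => i _; apply/eqP; have := nx i; rewrite negbK.
split=> [j|]; first by have := ge0 j; rewrite raiseE; case: eqP => _; lia.
by move: S; rewrite sum_raise PoszD => /(canRL (addrNK _)) ->; rewrite -addrA; congr (_ + _); lia.
Qed.

End MurnaghanNakayama.

Section CycleType.
Variable n : nat.
Implicit Types s : 'S_n.

Lemma mem_porbits s i : porbit s i \in porbits s.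
Proof. exact: imset_f. Qed.

Definition cycle_index s : {ffun 'I_n -> 'I_#|porbits s|} :=
  [ffun i => enum_rank_in (mem_porbits s i) (porbit s i)].

Lemma cycle_indexK s i : enum_val (cycle_index s i) = porbit s i.
Proof. by rewrite ffunE enum_rankK_in // mem_porbits. Qed.

Lemma fibre_cycle_index s c : fibre (cycle_index s) c = #|enum_val c|.
Proof.
rewrite ffunE; apply: eq_card => i; rewrite inE -(inj_eq enum_val_inj) cycle_indexK.
have /imsetP[j _ ->] := enum_valP c.
by rewrite eq_porbit_mem.
Qed.

Lemma cycle_type_codom s :
  [seq fibre (cycle_index s) c | c : 'I_#|porbits s|] =
  [seq #|C| | C : {set 'I_n} <- enum (porbits s)].
Proof.
transitivity (codom (fun c : 'I_#|porbits s| => #|enum_val c|)).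
  by apply: eq_codom => c; apply: fibre_cycle_index.
apply: (@eq_from_nth _ 0%N) => [|i]; first by rewrite size_image size_map card_ord cardE.
rewrite size_image card_ord => iC; rewrite (nth_map finset.set0) -?cardE //.
rewrite (nth_map (Ordinal iC)) ?size_enum_ord // (enum_val_nth finset.set0).
by rewrite nth_enum_ord.
Qed.

Lemma fixes_iter (T : finType) (F : {ffun 'I_n -> T}) s i j :
  fixes s F -> j \in porbit s i -> F j = F i.
Proof.
move=> /forallP sF /porbitP[k ->]; elim: k => [|k IH]; first by rewrite expg0 perm1.
by rewrite expgSr permM (eqP (sF _)).
Qed.

(** A colouring fixed by s is a colouring of the cycles of s. *)
Lemma jacobi_trudi_cycle_type N (x : 'rV[int]_N) s nu : has_cycle_type s nu ->
  jacobi_trudi n x s = mn_sum nu x.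
Proof.
rewrite /has_cycle_type -cycle_type_codom => p.
rewrite -(mn_sum_perm _ p) mn_sum_ffun jacobi_trudiE.
pose h (g : {ffun 'I_#|porbits s| -> 'I_N}) := [ffun i => g (cycle_index s i)].
have repP (c : 'I_#|porbits s|) : exists i, i \in enum_val c.
  by have /imsetP[j _ ->] := enum_valP c; exists j; apply: porbit_id.
pose rep c := xchoose (repP c).
have repK c : cycle_index s (rep c) = c.
  apply: enum_val_inj; rewrite cycle_indexK.
  have : rep c \in enum_val c := xchooseP (repP c).
  have /imsetP[j _ ->] := enum_valP c.
  by rewrite -eq_porbit_mem => /eqP.
rewrite (reindex_onto h (fun F => [ffun c => F (rep c)])) /=; last first.
  move=> F sF; apply/ffunP=> i; rewrite 2!ffunE; apply: (fixes_iter sF).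
  by rewrite -eq_porbit_mem -!cycle_indexK repK.
apply: eq_big => [g|g _].
  apply/andP; split; last by apply/eqP/ffunP=> c; rewrite 2!ffunE repK.
  apply/forallP=> i; rewrite ![h g _]ffunE; apply/eqP; congr (g _); apply: enum_val_inj.
  by rewrite !cycle_indexK; apply/eqP; rewrite eq_porbit_mem (mem_porbit s 1).
have -> : weight (h g) = content g (fibre (cycle_index s)) by rewrite content_fibre.
have -> // : [ffun c => fibre (cycle_index s) c] = fibre (cycle_index s).
by apply/ffunP=> c; rewrite ffunE.
Qed.

End CycleType.

(** Cut the points into consecutive rows of lengths nu and rotate each row. *)
Lemma exists_cycle_type (nu : seq nat) : 0%N \notin nu ->
  exists s : 'S_(sumn nu), has_cycle_type s nu.
Proof.
move=> nu0; set n := sumn nu.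
have nu_gt0 (k : nat) : (k < size nu)%N -> (0 < nth 0 nu k)%N.
  by move=> kn; rewrite lt0n; apply: contraNneq nu0 => <-; apply: mem_nth.
(* The t-th iterate of the rotation. *)
pose rot (t : nat) (i : nat) := flatten_index nu (reshape_index nu i)
  ((reshape_offset nu i + t) %% nth 0 nu (reshape_index nu i))%N.
have rot_lt t (i : 'I_n) : ((reshape_offset nu i + t) %% nth 0 nu (reshape_index nu i) <
   nth 0 nu (reshape_index nu i))%N.
  by rewrite ltn_mod; apply/nu_gt0/reshape_indexP.
have rotP (i : 'I_n) : (rot 1%N i < n)%N.
  exact/flatten_indexP/rot_lt.
have fI : injective (fun i => Ordinal (rotP i)).
  move=> i j /(congr1 val) /= ij; apply/val_inj.
  rewrite /= -(reshape_indexK nu i) -(reshape_indexK nu j).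
  have rij : reshape_index nu i = reshape_index nu j.
    by have := congr1 (reshape_index nu) ij; rewrite !flatten_indexKl ?rot_lt.
  have := congr1 (reshape_offset nu) ij; rewrite !flatten_indexKr ?rot_lt // rij.
  have := reshape_offsetP (ltn_ord i); have := reshape_offsetP (ltn_ord j); rewrite rij.
  move=> lj li /eqP; rewrite eqn_modDr !modn_small //; by move=> /eqP->.
pose s := perm fI; exists s.
have sE t i : (s ^+ t)%g i = rot t i :> nat.
  elim: t => [|t IH].
    rewrite expg0 perm1 /rot addn0 modn_small ?reshape_indexK //.
    exact/reshape_offsetP/ltn_ord.
  rewrite expgSr permM permE /= IH /rot flatten_indexKl ?rot_lt //.
  by rewrite flatten_indexKr ?rot_lt // modnDml addn1 addnS.
have orbE (i j : 'I_n) : (j \in porbit s i) = (reshape_index nu j == reshape_index nu i).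
  apply/porbitP/eqP => [[t ->]|ji].
    by rewrite sE flatten_indexKl ?rot_lt.
  exists (reshape_offset nu j + (nth 0 nu (reshape_index nu i) - reshape_offset nu i))%N.
  apply/val_inj; rewrite /= sE /rot -{1}(reshape_indexK nu j) ji; congr flatten_index.
  have := reshape_offsetP (ltn_ord i); have := reshape_offsetP (ltn_ord j); rewrite ji => lj li.
  rewrite addnCA subnKC; last exact: ltnW.
  by rewrite modnDr modn_small.
pose B (k : 'I_(size nu)) := [set j : 'I_n | reshape_index nu j == k].
have cardB k : #|B k| = nth 0%N nu k by apply: card_row.
have BI : injective B.
  move=> k l kl; have : (0 < #|B k|)%N by rewrite cardB nu_gt0.
  case/card_gt0P=> i ik; have := ik; rewrite {1}kl; move: ik; rewrite !inE.
  by move=> /eqP ik /eqP il; apply/val_inj; rewrite /= -ik il.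
have -> : nu = [seq #|C| | C : {set 'I_n} <- [seq B k | k : 'I_(size nu)]].
  rewrite -map_comp (eq_map cardB) /image_mem.
  by rewrite -[LHS](mkseq_nth 0%N) /mkseq -val_enum_ord -map_comp.
apply/perm_map/uniq_perm; rewrite ?enum_uniq ?(map_inj_uniq BI) ?enum_uniq //.
move=> C; rewrite mem_enum; apply/imsetP/mapP => [[i _ ->]|[k _ ->]].
  exists (Ordinal (reshape_indexP (ltn_ord i))); first by rewrite mem_enum.
  by apply/setP=> j; rewrite inE orbE.
have : (0 < #|B k|)%N by rewrite cardB nu_gt0.
case/card_gt0P=> i; rewrite inE => /eqP ik; exists i => //.
by apply/setP=> j; rewrite inE orbE ik.
Qed.

Section MnTheory.
Variable N : nat.
Implicit Types x y : 'rV[int]_N.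

Lemma mn_sum_col_perm (s : 'S_N) nu x :
  mn_sum nu (col_perm s x) = (-1) ^+ odd_perm s * mn_sum nu x.
Proof.
elim: nu x => [|k nu IH] x /=; first exact: pairing_perm.
rewrite mulr_sumr [RHS](reindex_inj (@perm_inj _ s)) /=; apply: eq_bigr => i _.
rewrite -IH; congr (mn_sum nu _); apply/rowP=> j.
by rewrite raiseE !mxE eqxx /= (inj_eq perm_inj); case: eqP => _; rewrite ?mulr1 // mulr0 addr0.
Qed.

Lemma mn_sum_eq0 nu x i j : i != j -> x 0 i = x 0 j -> mn_sum nu x = 0.
Proof.
move=> nij xij; have := mn_sum_col_perm (tperm i j) nu x.
rewrite odd_tperm nij expr1 mulN1r (_ : col_perm _ x = x).
  by move/eqP; rewrite -addr_eq0 -mulr2n mulrn_eq0 /= => /eqP.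
by apply/rowP=> l; rewrite mxE; case: tpermP => [->|->|].
Qed.

Lemma pairing_shift d x y : pairing (x + const_mx d) (y + const_mx d) = pairing x y.
Proof.
by congr (\det _); apply/matrixP=> i j; rewrite !mxE (inj_eq (addIr d)).
Qed.

End MnTheory.

Lemma raise_row_mxl m N k i (u : 'rV_m) (x : 'rV_N) :
  raise k (lshift N i) (row_mx u x) = row_mx (raise k i u) x.
Proof.
apply/rowP=> j; rewrite raiseE !mxE.
case: splitP => l jl.
  by rewrite raiseE -!val_eqE /= jl.
by rewrite ifF //; apply/negbTE; rewrite -val_eqE /= jl; have := ltn_ord i; lia.
Qed.

Lemma raise_row_mxr m N k i (u : 'rV_m) (x : 'rV_N) :
  raise k (rshift m i) (row_mx u x) = row_mx u (raise k i x).
Proof.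
apply/rowP=> j; rewrite raiseE !mxE.
case: splitP => l jl.
  by rewrite ifF //; apply/negbTE; rewrite -val_eqE /= jl; have := ltn_ord l; lia.
by rewrite raiseE -!val_eqE /= jl eqn_add2l.
Qed.

Lemma mn_sum_cons_row_mx m N k nu (u : 'rV_m) (x : 'rV_N) :
  mn_sum (k :: nu) (row_mx u x) =
  \sum_i mn_sum nu (row_mx (raise (- k%:Z) i u) x) +
  \sum_i mn_sum nu (row_mx u (raise (- k%:Z) i x)).
Proof.
rewrite /= big_split_ord /=; congr (_ + _); apply: eq_bigr => i _.
  by rewrite raise_row_mxl.
by rewrite raise_row_mxr.
Qed.

Lemma pairing_row_mx m N (u : 'rV_m) (x y : 'rV_N) : injective (u 0) ->
  (forall i j, u 0 i != y 0 j) -> pairing (row_mx u x) (row_mx u y) = pairing x y.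
Proof.
move=> uI uy; pose B := \matrix_(i < N, j < m) (x 0 i == u 0 j)%:R : 'M[algC]_(N, m).
rewrite /pairing (_ : \matrix_(i, j) _ =
   block_mx 1%:M 0 B (\matrix_(i, j) (x 0 i == y 0 j)%:R)) ?det_lblock ?det1 ?mul1r //.
apply/matrixP=> i j; rewrite !mxE.
case: splitP => a _; rewrite !mxE; case: splitP => b _; rewrite !mxE //.
  by rewrite (inj_eq uI).
by rewrite (negPf (uy _ _)).
Qed.

(** Lowering the entry - (N + 1) takes it out of the range of the vacuum. *)
Lemma mn_sum_vacuum N nu (x : 'rV_N) : 0%N \notin nu ->
  mn_sum nu (row_mx x (const_mx (- (N.+1)%:Z) : 'rV_1)) = mn_sum nu x.
Proof.
elim: nu x => [|k nu IH] x.
  move=> _; pose B := \matrix_(i < N, j < 1) (x 0 i == - (N.+1)%:Z)%:R : 'M[algC]_(N, 1).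
  rewrite /= /pairing (_ : \matrix_(i, j) _ =
    block_mx (\matrix_(i, j) (x 0 i == vac N 0 j)%:R) B 0 1%:M) ?det_ublock ?det1 ?mulr1 //.
  apply/matrixP=> i j; rewrite !mxE.
  case: splitP => a _; rewrite !mxE; case: splitP => b jb; rewrite !mxE jb //.
  - by congr (_ == _)%:R; have := ltn_ord b; lia.
  - by rewrite (_ : (_ == _) = false) //; have := ltn_ord b; lia.
  - by rewrite [b]ord1 [a]ord1 addn0 !eqxx.
rewrite inE negb_or => /andP[k0 nu0]; rewrite mn_sum_cons_row_mx.
rewrite [X in _ + X]big1 ?addr0 => [|i _]; first by apply: eq_bigr => i _; apply: IH.
apply/eqP; apply: contraT => /mn_sum_neq0[/(_ (rshift N i))].
by rewrite row_mxEr raiseE eqxx mxE; move: k0; lia.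
Qed.

From mathcomp Require Import boolp classical_sets functions cardinality fsbigop.

(** * Characters labelled by maya diagrams *)

Definition first_entries N (g : nat -> int) : 'rV[int]_N := \row_i g i.

Lemma decreasing_seq_excess (x : nat -> int) i j : decreasing_seq x ->
  (i <= j)%N -> x j + j%:Z <= x i + i%:Z.
Proof.
move=> decr; elim: j => [|j IH]; first by rewrite leqn0 => /eqP->.
rewrite leq_eqVlt => /orP[/eqP-> //|/IH].
by have := decr j j.+1 (ltnSn j); lia.
Qed.

Lemma maya_length_le (x : maya) N : vacuum_from x N -> (maya_length x <= N)%N.
Proof. by rewrite /maya_length => xN; case: ex_minnP => L _; apply; apply/asboolP. Qed.

Lemma maya_length_vacuum (x : maya) : vacuum_from x (maya_length x).
Proof. by rewrite /maya_length; case: ex_minnP => L /asboolP. Qed.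

Lemma maya_decreasing (x : maya) : decreasing_seq x.
Proof. by case/asboolP: (mayaP x). Qed.

Lemma maya_ge_vacuum (x : maya) i : - (i.+1)%:Z <= x i.
Proof.
have xL := @maya_length_vacuum x; set L := maya_length x in xL.
have := decreasing_seq_excess (@maya_decreasing x) (leq_addr L i).
by rewrite xL ?leq_addl //; lia.
Qed.

Lemma maya_partition_nth (x : maya) i :
  (nth 0%N (maya_partition x) i)%:Z = x i + (i.+1)%:Z.
Proof.
have [iL|Li] := ltnP i (maya_length x).
  by rewrite nth_mkseq //; have := maya_ge_vacuum x i; lia.
by rewrite nth_default ?size_mkseq // maya_length_vacuum // addNr.
Qed.

Lemma maya_partition_sorted (x : maya) : sorted geq (maya_partition x).
Proof.
apply/(sortedP 0%N) => i _; rewrite /geq /=.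
have := maya_partition_nth x i; have := maya_partition_nth x i.+1.
by have := @maya_decreasing x i i.+1 (ltnSn i); lia.
Qed.

Lemma maya_size_sum (x : maya) N : vacuum_from x N ->
  \sum_(i < N) x i = \sum_i vac N 0 i + (maya_size x)%:Z.
Proof.
move=> xN; have szN : (size (maya_partition x) <= N)%N.
  by rewrite size_mkseq maya_length_le.
have -> : maya_size x = (\sum_(i < N) nth 0 (maya_partition x) i)%N.
  rewrite /maya_size sumnE (big_nth 0%N) big_mkord.
  rewrite (big_ord_widen N (nth 0%N (maya_partition x))) // big_mkcond /=.
  by apply: eq_bigr => i _; case: ltnP => // h; rewrite nth_default.
rewrite -[X in _ = _ + X]natz natr_sum -big_split /=; apply: eq_bigr => i _.
by rewrite natz maya_partition_nth mxE; lia.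
Qed.

(** If no permutation has cycle type nu then the sizes of x and nu differ, and
    [mn_sum] vanishes because the energy does not come out right. *)
Lemma chiE (x : maya) N nu : vacuum_from x N -> 0%N \notin nu ->
  chi x nu = mn_sum nu (first_entries N x).
Proof.
move=> xN nu0; rewrite /chi; case: pickP => [s sP|nos].
  rewrite (@irr_sym_jacobi_trudi N _ (first_entries N x)) ?maya_partition_sorted //.
  - exact: jacobi_trudi_cycle_type.
  - by rewrite size_mkseq maya_length_le.
  - by move=> i; rewrite mxE maya_partition_nth; lia.
apply/esym/eqP; apply: contraT => /mn_sum_neq0[_].
under eq_bigr do rewrite mxE.
rewrite (maya_size_sum xN) => /addrI [] E.
by have := exists_cycle_type nu0; rewrite -E => -[s]; rewrite (nos s).
Qed.

(** * Inserting one entry of each residue *)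

Section Base.
Variables m N : nat.
Implicit Types x : 'rV[int]_N.

Definition staircase : 'rV[int]_m := \row_j ((m - j.+1)%N%:Z).

(** After the final shift by m the vacuum begins with the m new levels
    m - 1, ..., 0. *)
Lemma vac_shift : vac (m + N) + const_mx m%:Z = row_mx staircase (vac N).
Proof.
apply/rowP=> j; rewrite !mxE; case: splitP => a ja; rewrite !mxE ja.
  by have := ltn_ord a; lia.
by lia.
Qed.

(** The lowered level falls below the whole range. *)
Lemma pairing_staircase_ge x (t : 'I_m) : (N <= t)%N ->
  pairing (row_mx (raise (- m%:Z) t staircase) x) (row_mx staircase (vac N)) = 0.
Proof.
move=> Nt; apply/eqP; apply: contraT => /(pairing_neq0 (lshift N t)) [j].
rewrite row_mxEl raiseE eqxx !mxE; case: splitP => a _; rewrite mxE.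
  by have := ltn_ord t; lia.
by have := ltn_ord a; have := ltn_ord t; lia.
Qed.

(** The level t of the new block has gone down to the place of entry j of the
    vacuum. Transposing the two exhibits the same block at the head of both
    vectors, and it can be dropped. *)
Lemma pairing_staircase x (t : 'I_m) (j : 'I_N) : t = j :> nat ->
  pairing (row_mx (raise (- m%:Z) t staircase) x) (row_mx staircase (vac N)) =
  - pairing x (raise m%:Z j (vac N)).
Proof.
move=> tj; set u := raise _ t _; set y := raise _ j _.
have uE i : u 0 i = if i == t then - (j.+1)%:Z else (m - i.+1)%N%:Z.
  by rewrite raiseE mxE; case: eqP => [->|//]; have := ltn_ord t; lia.
have yE i : y 0 i = if i == j then (m - t.+1)%N%:Z else - (i.+1)%:Z.
  by rewrite raiseE mxE; case: eqP => [->|//]; have := ltn_ord t; lia.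
have -> : row_mx staircase (vac N) =
    col_perm (tperm (lshift N t) (rshift m j)) (row_mx u y).
  apply/rowP=> i; rewrite [RHS]mxE; case: tpermP => [->|->|].
  - by rewrite row_mxEr row_mxEl yE eqxx mxE.
  - by rewrite row_mxEl row_mxEr uE eqxx mxE.
  move=> it ij; rewrite !mxE; case: splitP => a ia; rewrite mxE ?uE ?yE ifF //.
    by apply/negbTE; apply: contra_notN it => /eqP <-; apply/val_inj.
  by apply/negbTE; apply: contra_notN ij => /eqP <-; apply/val_inj.
rewrite pairingC pairing_perm odd_tperm eq_lrshift /= expr1 mulN1r pairingC.
rewrite pairing_row_mx // => [i l|i l].
  rewrite !uE; have := ltn_ord i; have := ltn_ord l.
  case: eqP => [->|_]; case: eqP => [->|_] //.
  by move=> ? ? ?; apply/val_inj => /=; lia.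
rewrite uE yE; have := ltn_ord i; have := ltn_ord t.
have [_|] := eqVneq i t; have [_|] := eqVneq l j; rewrite -?val_eqE /=; lia.
Qed.

(** The raised entry of the vacuum meets another one. *)
Lemma pairing_vac_ge_size x (j : 'I_N) : (m <= j)%N -> (0 < m)%N ->
  pairing x (raise m%:Z j (vac N)) = 0.
Proof.
move=> mj m0; rewrite pairingC.
have jm : (j - m < N)%N by rewrite (leq_ltn_trans (leq_subr _ _)).
apply: (@pairing_eq0 _ j (Ordinal jm)); first by rewrite -val_eqE /=; lia.
by rewrite !raiseE eqxx -val_eqE /= ifF ?mxE /=; lia.
Qed.

Lemma sum_pairing_staircase x : (0 < m)%N ->
  \sum_(t < m) pairing (row_mx (raise (- m%:Z) t staircase) x) (row_mx staircase (vac N)) =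
  - mn_sum [:: m] x.
Proof.
move=> m0; rewrite /= sum_pairing_raise opprK -sumrN.
pose R (t : nat) : algC :=
  if insub t is Some j then - pairing x (raise m%:Z (j : 'I_N) (vac N)) else 0.
transitivity (\sum_(t < m) R t).
  apply: eq_bigr => t _; rewrite /R; case: insubP => [j _ jt|].
    by rewrite (pairing_staircase _ (esym jt)).
  by rewrite -leqNgt => /pairing_staircase_ge.
transitivity (\sum_(j < N) R j); last first.
  by apply: eq_bigr => j _; rewrite /R valK.
rewrite (big_ord_widen (m + N)%N R) ?leq_addr // (big_ord_widen (m + N)%N R) ?leq_addl //.
rewrite big_mkcond [RHS]big_mkcond /=; apply: eq_bigr => t _.
rewrite /R; case: insubP => [j -> jt|/negPf ->]; last by case: ifP.
by case: ltnP => //; rewrite -jt => mj; rewrite pairing_vac_ge_size ?oppr0.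
Qed.

End Base.

Section PhiIndex.
Variable m : nat.
Implicit Type a : {ffun 'I_m -> int}.

(** The sum of the entries is prescribed, so that lower bounds imply upper
    bounds. *)
Lemma phi_index_cover k (B : nat) : exists r : seq {ffun 'I_m -> int},
  [/\ uniq r, forall a, a \in r -> phi_index m k a &
      forall a, phi_index m k a -> (forall i, - B%:Z <= a i) -> a \in r].
Proof.
pose S := \sum_(i < m) (i : nat)%:Z - k * m%:Z.
(* The other entries are at least - B, which bounds a i + B from above. *)
pose K := (absz S + m * B + B)%N.
pose f (b : {ffun 'I_m -> 'I_K.+1}) : {ffun 'I_m -> int} := [ffun i => (b i : nat)%:Z - B%:Z].
have fI : injective f.
  move=> b c /ffunP bc; apply/ffunP=> i; apply/val_inj.
  by have := bc i; rewrite !ffunE => /addIr [].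
exists [seq a <- [seq f b | b : {ffun 'I_m -> 'I_K.+1}] | a \in phi_index m k].
split=> [|a|a aP aB]; first by rewrite filter_uniq // map_inj_uniq // enum_uniq.
  by rewrite mem_filter => /andP[/set_mem].
rewrite mem_filter (mem_set aP) /=.
have aK i : a i + B%:Z <= K%:Z.
  have [_] := aP; rewrite -/S (bigD1 i) //= => aS.
  have : - (m * B)%N%:Z <= \sum_(j < m | j != i) a j.
    apply: le_trans (ler_sum _ (fun j _ => aB j)).
    rewrite sumr_const -mulr_natl natz; have := max_card (predC1 i); rewrite card_ord.
    by set c := #|_| => cm; rewrite mulrN lerN2 -PoszM lez_nat leq_mul2r cm orbT.
  move: aS; set T := \sum_(_ < _ | _) _; set D := (m * B)%N => aS DT.
  by rewrite /K -/D; lia.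
have aE : a = f [ffun i => inord (absz (a i + B%:Z))].
  apply/ffunP=> i; rewrite !ffunE inordK.
    by rewrite gez0_abs ?addrK // -lerBlDr sub0r; apply: aB.
  by have := aB i; have := aK i; lia.
by rewrite aE map_f // mem_enum.
Qed.

Definition front a : 'rV[int]_m := \row_j a (rev_ord j).

Definition ground_lowered (t : 'I_m) : {ffun 'I_m -> int} :=
  [ffun i : 'I_m => (i : nat)%:Z - (if i == t then m%:Z else 0)].

Lemma front_ground_lowered t :
  front (ground_lowered (rev_ord t)) = raise (- m%:Z) t (staircase m).
Proof.
apply/rowP=> j; rewrite raiseE !mxE ffunE (inj_eq rev_ord_inj) /=.
by case: eqP => // _; rewrite subr0.
Qed.

Lemma ground_lowered_index t : phi_index m 1 (ground_lowered t).
Proof.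
split=> [i|].
  rewrite ffunE; case: eqP => _; last by rewrite subr0.
  by rewrite -[X in _ = (X %% _)%Z](subrK m%:Z) modzDr.
under eq_bigr do rewrite ffunE; rewrite big_split /= sumrN mul1r.
congr (_ - _); rewrite (bigD1 t) //= eqxx big1 ?addr0 // => i /negPf -> //.
Qed.

Lemma ground_lowered_inj : (0 < m)%N -> injective ground_lowered.
Proof.
move=> m0 s t /ffunP/(_ s); rewrite !ffunE eqxx; case: eqP => // _; lia.
Qed.

(** The differences (i - a_i) / m are natural numbers of sum 1. *)
Lemma phi_index_le a : (0 < m)%N -> phi_index m 1 a -> (forall i, a i < m%:Z) ->
  exists t, a = ground_lowered t.
Proof.
move=> m0 [amod asum] am.
pose d (i : 'I_m) := absz (((i : nat)%:Z - a i) %/ m%:Z)%Z.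
have dE i : (d i)%:Z * m%:Z = (i : nat)%:Z - a i.
  have E : (((i : nat)%:Z - a i) %/ m%:Z)%Z * m%:Z = (i : nat)%:Z - a i.
    by apply: divzK; rewrite -eqz_mod_dvd; apply/eqP/esym/amod.
  rewrite -[RHS]E; congr (_ * _); apply: gez0_abs.
  move: E; set e := (_ %/ _)%Z => E.
  have : - m%:Z < e * m%:Z by rewrite E; have := am i; lia.
  by rewrite -mulN1r ltr_pM2r //; lia.
have : (\sum_i d i == 1)%N.
  rewrite -(eqn_pmul2r m0) mul1n -eqz_nat PoszM; apply/eqP.
  rewrite -[X in X * _]natz natr_sum mulr_suml.
  under eq_bigr do rewrite natz dE.
  by rewrite big_split /= sumrN asum mul1r opprB addrC subrK.
case/sum_nat_eq1=> t [_ dt dj]; exists t; apply/ffunP=> i; rewrite ffunE.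
rewrite -[LHS](subKr (i : nat)%:Z) -dE; case: eqP => [->|/eqP it]; first by rewrite dt mul1r.
by rewrite dj // mul0r.
Qed.

(** Only the a that lower a single level contribute, by [phi_index_le]; on the
    other side P_m is moved to the vacuum by adjointness. *)
Lemma sum_phi_base N (x : 'rV[int]_N) : (0 < m)%N ->
  \sum_(a \in phi_index m 1)
     mn_sum [::] (row_mx (front a) x - const_mx m%:Z) = - mn_sum [:: m] x.
Proof.
move=> m0; rewrite -sum_pairing_staircase //.
have E a : mn_sum [::] (row_mx (front a) x - const_mx m%:Z) =
    pairing (row_mx (front a) x) (row_mx (staircase m) (vac N)).
  by rewrite -vac_shift /= -[LHS](pairing_shift m%:Z) subrK.
rewrite (@fsbigE _ _ _ _ _ [seq ground_lowered t | t : 'I_m]); first last.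
- move=> a aP anot; rewrite E; apply/eqP; apply: contraT => D.
  have [t at'] : exists t, a = ground_lowered t.
    apply: phi_index_le => // i.
    have [j] := pairing_neq0 (lshift N (rev_ord i)) D.
    rewrite row_mxEl mxE rev_ordK => ->; rewrite !mxE.
    by case: splitP => b _; rewrite mxE; lia.
  by case/negP: anot; rewrite at' map_f // mem_enum.
- by move=> a /= /mapP[t _ ->]; apply: ground_lowered_index.
- by rewrite map_inj_uniq ?enum_uniq //; apply: ground_lowered_inj.
rewrite big_map big_enum_cond /= (eq_bigl predT) => [|t]; last first.
  by rewrite mem_set //; apply: ground_lowered_index.
rewrite (reindex_inj rev_ord_inj) /=; apply: eq_bigr => t _.
by rewrite -front_ground_lowered -E.
Qed.

(** One finite list that serves all the sums whose terms vanish when some a_i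
    is below - B. *)
Lemma fsbig_phi_index k (B : nat) : exists r : seq {ffun 'I_m -> int},
  forall (V : nmodType) (f : {ffun 'I_m -> int} -> V),
    (forall a i, phi_index m k a -> a i < - B%:Z -> f a = 0) ->
  \sum_(a \in phi_index m k) f a = \sum_(a <- r) f a.
Proof.
have [r [r_uniq rP Pr]] := phi_index_cover k B; exists r => V f f0.
rewrite (@fsbigE _ _ _ _ _ r) //; last first.
  move=> a aP; apply: contraNeq => fa0; apply: Pr => // i.
  by rewrite leNgt; apply: contraNN fa0 => ai; rewrite (f0 _ _ aP ai) eqxx.
by rewrite big_seq_cond [RHS]big_seq; apply: eq_bigl => a; rewrite andb_idr // => /rP/mem_set.
Qed.

(** If r' is the residue of r - k, lowering entry r by k and then swapping the
    entries r and r' is the same as first applying this map to a and then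
    lowering entry r by k. *)
Definition exchange_pair (k : int) (r r' : 'I_m) a : {ffun 'I_m -> int} :=
  [ffun i => if i == r then a r' + k else if i == r' then a r - k else a i].

Lemma exchange_pairK k r r' : r != r' -> involutive (exchange_pair k r r').
Proof.
move=> rr a; apply/ffunP=> i; rewrite !ffunE !eqxx [r' == r]eq_sym (negPf rr).
case: eqP => [->|_]; first by rewrite subrK.
by case: eqP => [->|_]; rewrite ?addrK.
Qed.

Lemma exchange_pair_index k l (r r' : 'I_m) a : r != r' ->
    ((r' : nat)%:Z = (r : nat)%:Z - k %[mod m%:Z])%Z ->
  phi_index m l a -> phi_index m l (exchange_pair k r r' a).
Proof.
move=> rr rk [amod asum]; split=> [i|].
  rewrite ffunE; case: eqP => [->|_].
    by rewrite -modzDml (amod r') rk modzDml subrK.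
  by case: eqP => [->|_]; rewrite // -modzDml (amod r) modzDml -rk.
rewrite -asum (bigD1 r) //= [RHS](bigD1 r) //= !ffunE eqxx.
have rr' : r' != r by rewrite eq_sym.
rewrite [X in _ + X = _](bigD1 r') //= [X in _ = _ + X](bigD1 r') //=.
rewrite ffunE eqxx (negPf rr') !addrA; congr (_ + _); first by ring.
by apply: eq_bigr => i /andP[/negPf ir /negPf ir']; rewrite ffunE ir ir'.
Qed.

Lemma mn_sum_exchange_pair N nu k (r r' : 'I_m) (x : 'rV[int]_N) d a : r != r' ->
  mn_sum nu (row_mx (raise (- k) (rev_ord r) (front (exchange_pair k r r' a))) x - const_mx d) =
  - mn_sum nu (row_mx (raise (- k) (rev_ord r) (front a)) x - const_mx d).
Proof.
move=> rr; set y := row_mx (raise _ _ (front a)) x - _.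
have rr' : rev_ord r != rev_ord r' by rewrite (inj_eq rev_ord_inj).
rewrite (_ : _ - _ = col_perm (tperm (lshift N (rev_ord r)) (lshift N (rev_ord r'))) y).
  by rewrite mn_sum_col_perm odd_tperm eq_lshift rr' expr1 mulN1r.
have lE b i : (row_mx (raise (- k) (rev_ord r) (front b)) x - const_mx d) 0 (lshift N i) =
    (if rev_ord i == r then b (rev_ord i) - k else b (rev_ord i)) - d.
  by rewrite mxE row_mxEl raiseE !mxE -(inj_eq rev_ord_inj) rev_ordK.
apply/rowP=> i; rewrite [RHS]mxE.
have r'r : r' != r by rewrite eq_sym.
case: tpermP => [->|->|].
- by rewrite !lE !rev_ordK eqxx (negPf r'r) ffunE eqxx addrK.
- by rewrite !lE !rev_ordK eqxx (negPf r'r) ffunE eqxx (negPf r'r).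
rewrite /y -(splitK i); case: splitP => l _ il il'; rewrite /unsplit; last first.
  by rewrite mxE [RHS]mxE !row_mxEr.
have lr : rev_ord l != r.
  by apply: contra_notN il => /eqP <-; rewrite rev_ordK.
have lr' : rev_ord l != r'.
  by apply: contra_notN il' => /eqP <-; rewrite rev_ordK.
by rewrite !lE (negPf lr) ffunE (negPf lr) (negPf lr').
Qed.

(** The involution [exchange_pair] changes the sign of every term. *)
Lemma sum_phi_exchange N nu (k : nat) l (r : 'I_m) (x : 'rV[int]_N) : ~~ (m %| k)%N ->
  \sum_(a \in phi_index m l) mn_sum nu
     (row_mx (raise (- k%:Z) (rev_ord r) (front a)) x - const_mx m%:Z) = 0.
Proof.
move=> mk; have m0 : (0 < m)%N by apply: leq_ltn_trans (ltn_ord r).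
pose e := (((r : nat)%:Z - k%:Z) %% m%:Z)%Z.
have e0 : 0 <= e by rewrite modz_ge0 //; lia.
have em : e < m%:Z by rewrite ltz_pmod.
have eN : (absz e < m)%N by lia.
pose r' := Ordinal eN.
have r'E : ((r' : nat)%:Z = (r : nat)%:Z - k%:Z %[mod m%:Z])%Z.
  by rewrite /= gez0_abs // modz_mod.
have rr : r != r'.
  apply: contraNneq mk => rr; move/eqP: r'E; rewrite -rr eqz_mod_dvd.
  by rewrite opprB addrC subrK dvdzE.
set f := fun a => mn_sum nu _.
have [s sE] := fsbig_phi_index l N.
have f0 a i : phi_index m l a -> a i < - N%:Z -> f a = 0.
  move=> _ ai; apply/eqP; apply: contraT => /mn_sum_neq0[/(_ (lshift N (rev_ord i)))].
  by rewrite mxE row_mxEl raiseE !mxE rev_ordK (inj_eq rev_ord_inj); case: eqP => _; lia.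
suff : \sum_(a \in phi_index m l) f a = - \sum_(a \in phi_index m l) f a.
  by move/eqP; rewrite -addr_eq0 -mulr2n mulrn_eq0 /= => /eqP.
transitivity (\sum_(a \in phi_index m l) (- f a)); last first.
  by rewrite !sE // => [|a i aP ai]; rewrite ?sumrN // (f0 a i) ?oppr0.
rewrite (reindex_fsbig (exchange_pair k%:Z r r') (phi_index m l)).
  by apply: eq_fsbigr => a _; rewrite /f mn_sum_exchange_pair.
split.
- by move=> a; apply: exchange_pair_index.
- by move=> a b _ _; apply/inv_inj/exchange_pairK.
- move=> a aP; exists (exchange_pair k%:Z r r' a); last exact: exchange_pairK.
  exact: exchange_pair_index.
Qed.

Lemma sum_phi_index N nu (x : 'rV[int]_N) : (0 < m)%N ->
    (forall p, p \in nu -> ~~ (m %| p)%N) ->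
  \sum_(a \in phi_index m 1) mn_sum nu (row_mx (front a) x - const_mx m%:Z) =
  - mn_sum (m :: nu) x.
Proof.
move=> m0; elim: nu x => [|k nu IH] x mnu; first exact: sum_phi_base.
have [s sE] := fsbig_phi_index 1 N.
have mk : ~~ (m %| k)%N by apply: mnu; rewrite mem_head.
have {}IH y := IH y (fun p pn => mnu p (@mem_behead _ (k :: nu) p pn)).
have f0 (c : nat) mu j (y : 'rV[int]_N) a i : phi_index m 1 a -> a i < - N%:Z ->
    mn_sum mu (row_mx (raise (- c%:Z) j (front a)) y - const_mx m%:Z) = 0.
  move=> _ ai; apply/eqP; apply: contraT => /mn_sum_neq0[/(_ (lshift N (rev_ord i)))].
  by rewrite mxE row_mxEl raiseE !mxE rev_ordK; case: eqP => _; lia.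
pose o := Ordinal m0.
have g0 mu (y : 'rV[int]_N) a i : phi_index m 1 a -> a i < - N%:Z ->
    mn_sum mu (row_mx (front a) y - const_mx m%:Z) = 0.
  by move=> aP ai; rewrite -(raise0 o (front a)); apply: (f0 0%N _ _ _ _ i).
have raiseB c i (y : 'rV[int]_(m + N)) :
    raise c i (y - const_mx m%:Z) = raise c i y - const_mx m%:Z.
  by rewrite /raise addrAC.
rewrite [mn_sum (m :: _) x](mn_sum_cons_cat [:: m]) [mn_sum (k :: _) x]/=.
rewrite sE; last by move=> a i; apply: g0.
transitivity (\sum_(a <- s) (\sum_(r < m) mn_sum nu
     (row_mx (raise (- k%:Z) (rev_ord r) (front a)) x - const_mx m%:Z) +
   \sum_(i < N) mn_sum nu (row_mx (front a) (raise (- k%:Z) i x) - const_mx m%:Z))).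
  apply: eq_bigr => a _; rewrite /= big_split_ord /=; congr (_ + _).
    rewrite (reindex_inj rev_ord_inj); apply: eq_bigr => i _.
    by rewrite raiseB raise_row_mxl.
  by apply: eq_bigr => i _; rewrite raiseB raise_row_mxr.
rewrite big_split /= exchange_big [X in X + _]big1 ?add0r => [|r _]; last first.
  by rewrite -sE => [|a i]; [apply: sum_phi_exchange | apply: f0].
rewrite exchange_big -sumrN; apply: eq_bigr => i _.
by rewrite -sE; [apply: IH | move=> a j; apply: g0].
Qed.

End PhiIndex.

(** * Evaluating characters on wedges *)

Lemma mn_sum_first_entries (g : nat -> int) L L' nu : vacuum_from g L -> (L <= L')%N ->
  0%N \notin nu -> mn_sum nu (first_entries L' g) = mn_sum nu (first_entries L g).
Proof.
move=> gL /subnKC <- nu0; elim: (L' - L)%N => [|j IH]; first by rewrite addn0.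
rewrite -IH addnS -addn1 -[RHS]mn_sum_vacuum //; congr (mn_sum nu _).
apply/rowP=> i; rewrite !mxE; case: splitP => l il; rewrite mxE il //.
by rewrite ord1 addn0 gL ?leq_addr.
Qed.

Lemma perm_nat_lift N (s : 'S_N) i :
  perm_nat (lift_perm ord_max ord_max s) i = perm_nat s i.
Proof.
rewrite /perm_nat; case: insubP => [j ji ij|iN]; last first.
  by rewrite insubF //; apply: contraNF iN => /ltnW.
have [iN|Ni] := ltnP i N.
  have -> : j = fintype.lift ord_max (Ordinal iN).
    by apply/val_inj; rewrite /= ij /bump leqNgt iN.
  rewrite lift_perm_lift (insubT (fun k => (k < N)%N) iN) /= /bump.
  by rewrite leqNgt ltn_ord.
have -> : j = ord_max by apply/val_inj; rewrite /= ij; lia.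
by rewrite lift_perm_id insubF /=; lia.
Qed.

(** Extending a permutation by fixed points preserves its sign. *)
Lemma perm_nat_widen N (s : 'S_N) k : exists2 t : 'S_(k + N),
  odd_perm t = odd_perm s & forall i, perm_nat t i = perm_nat s i.
Proof.
elim: k => [|k [t ts tE]]; first by exists s.
exists (lift_perm ord_max ord_max t) => [|i]; last by rewrite perm_nat_lift.
by rewrite odd_lift_perm addbb ts.
Qed.

Lemma perm_nat_ord N (s : 'S_N) (i : 'I_N) : perm_nat s i = s i.
Proof. by rewrite /perm_nat valK. Qed.

Lemma perm_nat_ge N (s : 'S_N) i : (N <= i)%N -> perm_nat s i = i.
Proof. by move=> Ni; rewrite /perm_nat insubF // ltnNge Ni. Qed.

Lemma perm_natK N (s : 'S_N) i : perm_nat s (perm_nat s^-1 i) = i.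
Proof.
have [iN|Ni] := ltnP i N; last by rewrite !perm_nat_ge.
by rewrite -[i]/(val (Ordinal iN)) !perm_nat_ord permKV.
Qed.

Lemma perm_natVK N (s : 'S_N) : cancel (perm_nat s) (perm_nat s^-1).
Proof. by move=> i; rewrite -{2}(perm_natK s^-1 i) invgK. Qed.

Lemma decreasing_seq_inj (x : nat -> int) : decreasing_seq x -> injective x.
Proof.
move=> xdecr i j xij; case: (ltngtP i j) => // /xdecr; by rewrite xij ltxx.
Qed.

Lemma chi_lin_ket z nu : chi_lin (ket z) nu = chi z nu.
Proof. by rewrite /chi_lin /ket lin_extU. Qed.

Lemma chi_linZ c kappa nu : chi_lin (c *: kappa) nu = c * chi_lin kappa nu.
Proof. by rewrite /chi_lin linearZ. Qed.

Section WedgeValue.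
Variables (d : int) (f : nat -> int) (L : nat) (nu : seq nat).
Hypothesis nu0 : 0%N \notin nu.
Let g i := f i + d.
Hypothesis gL : vacuum_from g L.

Lemma rearranges_value N (s : 'S_N) (y : charged_maya) :
    rearranges f (existT _ N s, y) ->
  chi_lin (charged_to_fock (shift d (cket y))) nu =
  (-1) ^+ odd_perm s * mn_sum nu (first_entries L g).
Proof.
move=> fE; have [t <- tE] := perm_nat_widen s L.
pose y' := shift_charged d y.
have gE i : g i = y' (perm_nat t i) by rewrite tE /g fE.
have y'L : vacuum_from y' (L + N).
  move=> i Li; rewrite -gL ?gE; last by apply: leq_trans Li; rewrite leq_addr.
  by rewrite perm_nat_ge.
have y'maya : `[< is_maya y' >].
  apply/asboolP; split; last by exists (L + N)%N.
  by move=> i j ij; rewrite ltrD2r; case/asboolP: (charged_mayaP y) => h _; apply: h.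
have -> : shift d (cket y) = cket y' by rewrite /shift /cket /= lin_extU.
have -> : charged_to_fock (cket y') = ket (Maya y'maya).
  rewrite /charged_to_fock /cket /= lin_extU.
  case: insubP => [z _ zy|]; last by rewrite y'maya.
  by congr ket; apply: val_inj.
rewrite chi_lin_ket (@chiE _ (L + N)) //.
rewrite -(mn_sum_first_entries gL (leq_addr N L)) //.
have -> : first_entries (L + N) g = col_perm t (first_entries (L + N) y').
  by apply/rowP=> i; rewrite !mxE gE perm_nat_ord.
by rewrite mn_sum_col_perm mulrA -signr_addb addbb mul1r.
Qed.

(** A nonzero [mn_sum] forces the first entries to be distinct and within the
    range of the vacuum, hence above the tail: sorting them is enough. *)
Lemma mn_sum_rearranges : mn_sum nu (first_entries L g) != 0 -> exists p, rearranges f p.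
Proof.
move=> D; have [ge0 _] := mn_sum_neq0 D.
pose s := [tuple g i | i < L].
have gI : {in gtn L &, injective g}.
  move=> i j; rewrite !inE => iL jL gij; apply/eqP; apply: contra_neqT D => ij.
  by apply: (@mn_sum_eq0 _ _ _ (Ordinal iL) (Ordinal jL)); rewrite ?mxE.
have /tuple_permP[p pE] : perm_eq (sort >=%O s) s by rewrite perm_sort.
pose z i := f (perm_nat p i).
have zlt i j : (i < j)%N -> z j < z i.
  move=> ij; rewrite -(ltrD2r d) -!/(g _).
  have [jL|Lj] := ltnP j L; last first.
    rewrite [perm_nat p j]perm_nat_ge // gL //; have [iL|Li] := ltnP i L.
      rewrite -[i]/(val (Ordinal iL)) perm_nat_ord.
      by have := ge0 (p (Ordinal iL)); rewrite mxE; lia.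
    by rewrite perm_nat_ge // gL //; lia.
  have iL := ltn_trans ij jL.
  have nthE (k : 'I_L) : nth 0 (sort >=%O s) k = g (p k).
    by rewrite pE -tnth_nth tnth_mktuple /s tnth_mktuple.
  rewrite -[i]/(val (Ordinal iL)) -[j]/(val (Ordinal jL)) !perm_nat_ord.
  rewrite lt_neqAle; apply/andP; split.
    apply/eqP => /gI; rewrite !inE !ltn_ord => /(_ isT isT) /val_inj /perm_inj [].
    by move=> ji; rewrite ji ltnn in ij.
  have ge_tr : transitive (>=%O : rel int) by apply/rev_trans/le_trans.
  have := sorted_leq_nth ge_tr ge_refl 0 (sort_sorted ge_total s).
  rewrite -!nthE => /(_ i j); rewrite !inE size_sort size_tuple; apply=> //.
  exact: ltnW.
have zmaya : `[< is_charged_maya z >].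
  apply/asboolP; split=> //; exists L => i Li.
  apply: (addIr d); rewrite addrAC -!/(g _) !perm_nat_ge ?leqW //.
  by rewrite !gL ?leqW //; lia.
exists (existT _ L p^-1%g, ChargedMaya zmaya) => i /=.
by rewrite /z perm_natK.
Qed.

(** Both sides are antisymmetric in the entries of f. They agree on decreasing
    sequences by [chiE], and vanish together when f cannot be sorted. *)
Lemma wedge_value :
  chi_lin (charged_to_fock (shift d (wedge f))) nu = mn_sum nu (first_entries L g).
Proof.
rewrite /wedge; case: pselect => [ex|nex]; last first.
  rewrite /chi_lin !linear0; apply/esym/eqP; apply: contraT => /mn_sum_rearranges //.
case: cid => -[[N s] y] /= fE.
rewrite !linearZ /= chi_linZ (rearranges_value fE).
by rewrite mulrA -signr_addb addbb mul1r.
Qed.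

End WedgeValue.

Section PhiValue.
Variables (m : nat) (lambda : maya) (L : nat) (nu : seq nat).
Hypothesis lambdaL : vacuum_from lambda L.
Hypothesis nu0 : 0%N \notin nu.

Lemma first_entries_prepend (a : {ffun 'I_m -> int}) :
  first_entries (m + L) (fun i => prepend a lambda i + - m%:Z) =
  row_mx (front a) (first_entries L lambda) - const_mx m%:Z.
Proof.
apply/rowP=> i; rewrite !mxE; congr (_ - _); rewrite /prepend.
case: splitP => j ij; rewrite mxE ij; first by rewrite valK.
by rewrite insubF ?addKn //; apply/negbTE; rewrite -leqNgt leq_addr.
Qed.

Lemma prepend_vacuum (a : {ffun 'I_m -> int}) :
  vacuum_from (fun i => prepend a lambda i + - m%:Z) (m + L).
Proof.
move=> i Li; have mi : (m <= i)%N by apply: leq_trans Li; rewrite leq_addr.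
rewrite /prepend insubF; last by rewrite ltnNge mi.
by rewrite lambdaL; lia.
Qed.

Lemma wedge_prepend_value (a : {ffun 'I_m -> int}) :
  chi_lin (charged_to_fock (shift (- m%:Z) (wedge (prepend a lambda)))) nu =
  mn_sum nu (row_mx (front a) (first_entries L lambda) - const_mx m%:Z).
Proof. by rewrite (wedge_value nu0 (prepend_vacuum a)) first_entries_prepend. Qed.

(** The entry a i repeats one of the tail of lambda. *)
Lemma wedge_prepend_eq0 (a : {ffun 'I_m -> int}) i :
  a i < - L%:Z -> wedge (prepend a lambda) = 0.
Proof.
move=> aL; rewrite /wedge; case: pselect => // -[[[N s] y] /= fE].
have [ydecr _] := asboolP _ (charged_mayaP y).
pose t := (absz (a i)).-1.
have Lt : (L <= t)%N by rewrite /t; lia.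
have : prepend a lambda (rev_ord i) = prepend a lambda (m + t)%N.
  rewrite /prepend valK rev_ordK insubF; last by rewrite ltnNge leq_addr.
  by rewrite addKn lambdaL // /t; lia.
rewrite !fE => /(decreasing_seq_inj ydecr)/(can_inj (perm_natVK s)) => it.
by have := ltn_ord (rev_ord i); rewrite it; lia.
Qed.

Lemma chi_lin_phi k : chi_lin (phi m k (ket lambda)) nu =
  \sum_(a \in phi_index m k) mn_sum nu (row_mx (front a) (first_entries L lambda) - const_mx m%:Z).
Proof.
have [r rE] := fsbig_phi_index m k L.
rewrite /phi /ket /= lin_extU /phi_maya rE; last by move=> a i _; apply: wedge_prepend_eq0.
rewrite rE; last first.
  by move=> a i _ /wedge_prepend_eq0 w0; rewrite -wedge_prepend_value w0 /chi_lin !linear0.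
rewrite /chi_lin !linear_sum; apply: eq_bigr => a _; exact: wedge_prepend_value.
Qed.

End PhiValue.

Theorem theorem2p2 (m n : nat) (hm : (1 < m)%N)
    (lambda : maya) (hlambda : maya_size lambda = n)
    (hmn : (m <= n)%N) (mu : seq nat) (hmu : is_partition_of (n - m)%N mu)
    (hmum : forall p : nat, p \in mu -> ~~ (m %| p)%N) :
  chi lambda (add_part m mu) = chi_lin (- phi m 1 (ket lambda)) mu.
Proof.
have m0 : (0 < m)%N by apply: ltnW.
have /and3P[_ mu0 _] := hmu.
have lL := @maya_length_vacuum lambda; set L := maya_length lambda in lL.
rewrite -scaleN1r chi_linZ mulN1r (chi_lin_phi m lL) // sum_phi_index // opprK.
rewrite (chiE lL) /add_part; last by rewrite mem_sort inE negb_or mu0 andbT; lia.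
by apply: mn_sum_perm; rewrite perm_sort.
Qed.
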